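(* Let $l>0$, $p=\frac{l+2}{l+1}$, $q=l+2$. Suppose that the Nash inequality $$\mu\big((f-\mu(f))^2\big)\le C\,\mathcal{E}(f,f)^{1/p}\,\Phi(f)^{1/q}\qquad\text{for all } f\in\mathcal{D}(\mathcal{E})$$ holds for some constant $C>0$ and some functional $\Phi:L^2(\mu)\to[0,\infty]$ with $\Phi(cf)=c^2\Phi(f)$ for all $c\in\mathbb{R}$, $f\in L^2(\mu)$, and that for some constant $C'>0$ $$\Phi(f)\le C'\,\|f-\mu(f)\|_\infty^2\qquad\text{for all } f\in L^2(\mu).$$ Then for every $\varepsilon$ with $0<\varepsilon<l+1$ and every open set $G\subseteq\mathtt{E}$ with $\mu(G^c)>0$, the function $x\mapsto\mathbb{E}_x\tau_G^{\,l+1-\varepsilon}$ belongs to $L^1(\mathbf{1}_G\cdot\mu)$.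
   Context: $\mathtt{E}$ is a locally compact space with countable base (LCCB), $\mu$ a Radon probability measure on $\mathtt{E}$, and $X=(X_t)_{t\ge0}$ a conservative $\mu$-symmetric Hunt process on $\mathtt{E}$ with associated Dirichlet form $(\mathcal{E},\mathcal{D}(\mathcal{E}))$ on $L^2(\mu)$. $\mathbb{E}_x$ is the expectation for $X$ started at $x$, $\tau_G=\inf\{t\ge0:X_t\notin G\}$ is the exit time from $G$, $\mu(f)=\int f\,d\mu$, and $\|\cdot\|_\infty$ is the essential supremum norm (possibly $+\infty$); $0\cdot\infty=0$ by convention. *)

(* Defs.v *)
From HB Require Import structures.
From mathcomp Require Import all_boot all_order all_algebra.
From mathcomp Require Import all_classical all_reals all_analysis.
From mathcomp Require Import measurable_realfun ess_sup_inf.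

Set Implicit Arguments.
Unset Strict Implicit.
Unset Printing Implicit Defensive.
Import Order.TTheory GRing.Theory Num.Theory.
Import numFieldNormedType.Exports.

Local Open Scope classical_set_scope.
Local Open Scope ring_scope.

(* Pointedness of the state space is only what the library needs to build the
   Borel sigma-algebra; a space carrying a probability measure is nonempty. *)
Notation borel E := (g_sigma_algebraType (@open E)).

Definition LCCB (E : ptopologicalType) : Prop :=
  [/\ hausdorff_space E, locally_compact [set: E] & @second_countable E].

Definition radon (R : realType) (E : ptopologicalType)
    (mu : {measure set (borel E) -> \bar R}) : Prop :=
  [/\ forall K : set E, compact K -> (mu K < +oo)%E,
      forall A : set (borel E), measurable A ->
        mu A = ereal_inf [set mu U | U in [set U : set E | open U /\ A `<=` U]] &
      forall U : set E, open U ->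
        mu U = ereal_sup [set mu K | K in [set K : set E | compact K /\ K `<=` U]]].

(* E_Delta, with cemetery Delta = None; when E is compact, Delta is isolated. *)
Notation cemetery E := (one_point_compactification E).

Section process.
Context {R : realType} {E : ptopologicalType}.
Context {d : measure_display} {Omega : measurableType d}.
Implicit Types (X : R -> Omega -> cemetery E) (M : R -> set (set Omega)).

(* Only times t >= 0 are ever constrained. *)

Definition lifetime X (w : Omega) : \bar R :=
  ereal_inf [set t%:E | t in [set t : R | 0 <= t /\ X t w = None]].

(* For a Hunt process and open G this equals, P_x-a.s. for every x, a measurable
   function.  The integral of a nonnegative function is the supremum over the
   measurable simple functions below it, so it ignores P_x-null sets and E_x of a
   power of the exit time is the integral for the completion of P_x. *)
Definition exit_time X (G : set E) (w : Omega) : \bar R :=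
  ereal_inf [set t%:E | t in [set t : R | 0 <= t /\ ~ (Some @` G) (X t w)]].

Record right_continuous_filtration M : Prop := {
  filtration_sigma_algebra : forall t : R, 0 <= t -> sigma_algebra [set: Omega] (M t) ;
  filtration_sub : forall t : R, 0 <= t -> M t `<=` measurable ;
  filtration_mono : forall s t : R, 0 <= s -> s <= t -> M s `<=` M t ;
  filtration_right : forall t : R, 0 <= t ->
    forall A, (forall s, t < s -> M s A) -> M t A }.

Definition adapted M X : Prop :=
  forall (t : R) (B : set (borel (cemetery E))), 0 <= t -> measurable B ->
    M t (X t @^-1` B).

Definition stopping_time M (sigma : Omega -> \bar R) : Prop :=
  (forall w, (0 <= sigma w)%E) /\
  (forall t : R, 0 <= t -> M t [set w | (sigma w <= t%:E)%E]).

Definition stopped_events M (sigma : Omega -> \bar R) : set (set Omega) :=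
  [set A | measurable A /\
    forall t : R, 0 <= t -> M t (A `&` [set w | (sigma w <= t%:E)%E])].

(* The position X_{sigma + s}; meaningful on {sigma < +oo} only. *)
Definition at_time X (sigma : Omega -> \bar R) (s : R) (w : Omega) : cemetery E :=
  X (fine (sigma w) + s) w.

(* P_x(X_{sigma+s} \in B | M_sigma) = P_{X_sigma}(X_s \in B), P_x-a.s. on
   {sigma < +oo}, written in integrated form. *)
Definition strong_markov M X (P : cemetery E -> probability Omega R) : Prop :=
  forall (x : cemetery E) (sigma : Omega -> \bar R) (A : set Omega)
      (s : R) (B : set (borel (cemetery E))),
    stopping_time M sigma -> stopped_events M sigma A ->
    0 <= s -> measurable B ->
    let A' := A `&` [set w | (sigma w < +oo)%E] in
    P x (A' `&` at_time X sigma s @^-1` B) =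
    (\int[P x]_(w in A') P (at_time X sigma 0%R w) (X s @^-1` B))%E.

Definition quasi_left_continuous M X
    (P : cemetery E -> probability Omega R) : Prop :=
  forall (x : cemetery E) (sigma_ : nat -> Omega -> \bar R),
    (forall n, stopping_time M (sigma_ n)) ->
    (forall n w, (sigma_ n w <= sigma_ n.+1 w)%E) ->
    let sigma w := ereal_sup (range (sigma_ ^~ w)) in
    {ae P x, forall w, (sigma w < +oo)%E ->
      at_time X (sigma_ n) 0 w @[n --> \oo] --> at_time X sigma 0 w}.

(* Hunt processes in the sense of Fukushima-Oshima-Takeda.  The strong Markov
   property and quasi-left-continuity are required under every P_x; integrating
   in x gives them under every initial law.  The simple Markov property is the
   case of a constant stopping time. *)
Record hunt_process X (P : cemetery E -> probability Omega R) : Prop := {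
  hunt_measurable : forall t : R, 0 <= t ->
    measurable_fun setT (X t : Omega -> borel (cemetery E)) ;
  hunt_kernel : forall (t : R) (B : set (borel (cemetery E))), 0 <= t -> measurable B ->
    measurable_fun [set: borel (cemetery E)]
      ((fun x => P x (X t @^-1` B)) : borel (cemetery E) -> \bar R) ;
  hunt_normal : forall x, P x [set w | X 0 w = x] = 1%E ;
  hunt_cemetery : forall w (t : R), 0 <= t -> (lifetime X w <= t%:E)%E -> X t w = None ;
  hunt_shift : forall t : R, 0 <= t -> exists theta : Omega -> Omega,
    forall (s : R) w, 0 <= s -> X s (theta w) = X (t + s) w ;
  hunt_right_continuous : forall w (t : R), 0 <= t -> X s w @[s --> t^'+] --> X t w ;
  hunt_left_limits : forall w (t : R), 0 < t -> cvg (X s w @[s --> t^'-]) ;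
  hunt_strong : exists M, [/\ right_continuous_filtration M, adapted M X,
    strong_markov M X P & quasi_left_continuous M X P] }.

Definition conservative X (P : cemetery E -> probability Omega R) : Prop :=
  forall x : E, P (Some x) [set w | lifetime X w = +oo%E] = 1%E.

(* p_t f(x) = E_x f(X_t), functions on E being extended by 0 at Delta. *)
Definition transition X (P : cemetery E -> probability Omega R) (t : R)
    (f : E -> \bar R) (x : E) : \bar R :=
  (\int[P (Some x)]_w oapp f 0 (X t w))%E.

Definition symmetric_process (mu : {measure set (borel E) -> \bar R}) X
    (P : cemetery E -> probability Omega R) : Prop :=
  forall (t : R) (f g : borel E -> \bar R), 0 <= t ->
    measurable_fun setT f -> measurable_fun setT g ->
    (forall x, (0 <= f x)%E) -> (forall x, (0 <= g x)%E) ->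
    (\int[mu]_x (transition X P t f x * g x) =
     \int[mu]_x (f x * transition X P t g x))%E.

(* The L^2 semigroup T_t f; for f in L^2(mu) the integral is absolutely
   convergent for mu-almost every x, and the value elsewhere is immaterial. *)
Definition semigroup X (P : cemetery E -> probability Omega R) (t : R)
    (f : E -> R) (x : E) : R :=
  fine (transition X P t (EFin \o f) x).

(* The Dirichlet form of a symmetric semigroup through its approximating forms
   E^(t)(f, g) = (f - T_t f, g) / t.  As t decreases to 0, E^(t)(f, f) is
   nonnegative and nondecreasing, so it converges in R iff its limit is finite. *)
Definition approximating_form (mu : {measure set (borel E) -> \bar R}) X
    (P : cemetery E -> probability Omega R) (f g : E -> R) (t : R) : R :=
  t^-1 * \int[mu]_x ((f x - semigroup X P t f x) * g x).

Definition dirichlet_form (mu : {measure set (borel E) -> \bar R}) X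
    (P : cemetery E -> probability Omega R) (f g : E -> R) : R :=
  lim (approximating_form mu X P f g t @[t --> 0^'+]).

Definition dirichlet_domain (mu : {measure set (borel E) -> \bar R}) X
    (P : cemetery E -> probability Omega R) : set (borel E -> R) :=
  [set f | f \in Lfun mu 2%:E /\
           cvg (approximating_form mu X P f f t @[t --> 0^'+])].

End process.

(* Functionals L^2(mu) -> [0, +oo], as functionals on square-integrable
   functions that do not distinguish a.e. equal ones. *)
Definition L2_functional (R : realType) (E : ptopologicalType)
    (mu : {measure set (borel E) -> \bar R})
    (Phi : (borel E -> R) -> \bar R) : Prop :=
  (forall f, f \in Lfun mu 2%:E -> (0 <= Phi f)%E) /\
  (forall f g, f \in Lfun mu 2%:E -> g \in Lfun mu 2%:E ->
    f = g %[ae mu] -> Phi f = Phi g).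

(* Main.v *)
Require Import Defs.
From HB Require Import structures.
From mathcomp Require Import all_boot all_order all_algebra.
From mathcomp Require Import all_classical all_reals all_analysis.
From mathcomp Require Import measurable_realfun ess_sup_inf.
From mathcomp Require Import ring lra.

Set Implicit Arguments.
Unset Strict Implicit.
Unset Printing Implicit Defensive.
Import Order.TTheory GRing.Theory Num.Theory.
Import numFieldNormedType.Exports.

Local Open Scope classical_set_scope.
Local Open Scope ring_scope.

(** Write p_t for the transition semigroup of X, Q = p_1, and |f| for the norm
    of L^2(mu).  Put v_0 = 1_G and v_(n+1) = 1_G Q v_n, so that v_n x is the
    P_x-probability that X_0, ..., X_n all lie in G [skeleton_survival].  Since
    Q is symmetric, the mu-integral of v_(2n) equals W_n = |v_n|^2
    [survival_double]; hence, started from mu, the exit time exceeds 2n with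
    probability at most W_n.  Once W_n = O(n^-(l+1)) is known, cutting the
    expectation of tau_G^(l+1-eps) at the levels 2^k [poweR_tail_bound]
    leaves a geometric series of ratio 2^-eps.

    The decay of W_n comes from the Nash inequality applied to Q v_n.  For f
    with values in [0, 1] the function t |-> (f, p_t f) is convex, because its
    second differences are squares |p_(s/2) f - p_(s/2+d) f|^2.  The slopes
    that define the Dirichlet form of Q f are the right slopes of this function
    at t = 2; they are monotone, hence convergent, and are dominated by the
    slope of the chord over [0, 2].  So Q f belongs to the domain and
    2 E(Q f, Q f) <= |f|^2 - |Q f|^2 [energy_dissipation].  For f = v_n the
    right-hand side is at most W_n - W_(n+1).  The oscillation of Q v_n being at
    most 1, the functional Phi is at most C' there, so the Nash inequality bounds the
    variance of Q v_n by a constant times (W_n - W_(n+1))^(1/p)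
    [nash_dissipation].  On the other hand v_n vanishes on the complement of G,
    which has positive mass, so the variance of v_n is at least a constant
    times W_n.  Together W_n - W_(n+1) >= c W_n^p with p - 1 = 1/(l+1)
    [survival_energy_decay], and such a sequence is O(n^-(l+1))
    [difference_decay].  Sampling at integer times puts the killed
    chain in place of the part process on G, and its symmetry is that of Q.

    It remains to see that x |-> E_x tau_G^b is Borel, although tau_G need not
    be measurable on Omega.  Exhaust G by compact sets D_n such that every
    point of G is interior to some D_n.  The exit times of the D_n are stopping
    times [exit_time_stopping] and increase to a limit; by quasi-left-continuity
    X has left G at that limit, so the limit is P_x-almost surely tau_G, for
    every x [exit_time_announced].  The limit is measurable, and its law
    depends measurably on x since the event that X stays in D_n up to time t
    is a decreasing intersection of dyadic skeleton events, whose
    probabilities are iterated integrals [kernel_event_stay,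
    measurable_expectation_announced]. *)

(** * Convex functions and power-law recursions on the real line *)

Section convexity.
Context {R : realType}.

(** Every increment up to m is at most every increment after m, so averages of
    initial increments grow with the length. *)
Lemma convex_seq_chord (a : nat -> R) (m n : nat) :
    (forall k, a k.+1 - a k <= a k.+2 - a k.+1) -> (m <= n)%N ->
  n%:R * (a m - a 0%N) <= m%:R * (a n - a 0%N).
Proof.
move=> cvx_a le_mn.
have incr i j : (i <= j)%N -> a i.+1 - a i <= a j.+1 - a j.
  move=> /subnK <-; elim: (j - i)%N => [//|k IHk].
  by apply: le_trans IHk _; exact: cvx_a.
have low k : a k - a 0%N <= k%:R * (a k.+1 - a k).
  elim: k => [|k IHk]; first by rewrite subrr mul0r.
  rewrite -natr1 mulrDl mul1r; have := cvx_a k.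
  have : k%:R * (a k.+1 - a k) <= k%:R * (a k.+2 - a k.+1) by rewrite ler_wpM2l.
  move: IHk; lra.
move: le_mn => /subnK <-; elim: (n - m)%N => [//|k IHk].
rewrite addSn -natr1 mulrDl mul1r.
have : m%:R * (a m.+1 - a m) <= m%:R * (a (k + m).+1 - a (k + m)%N).
  by rewrite ler_wpM2l// incr// leq_addl.
move: IHk (low m); rewrite !mulrBr; lra.
Qed.

Context (phi : R -> R).
Hypothesis phi_mid : forall x d : R, 0 <= x -> 0 <= d ->
  0 <= phi x - 2 * phi (x + d) + phi (x + d *+ 2).
Hypothesis phi_ub : forall x : R, 0 <= x -> phi x <= 1.
Hypothesis phi_lb : forall x : R, 0 <= x -> 0 <= phi x.

Let grid_convex (x d : R) : 0 <= x -> 0 <= d -> forall k,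
  phi (x + d *+ k.+1) - phi (x + d *+ k) <= phi (x + d *+ k.+2) - phi (x + d *+ k.+1).
Proof.
move=> x0 d0 k; have := @phi_mid (x + d *+ k) d.
rewrite addr_ge0 ?mulrn_wge0// => /(_ isT d0).
have -> : x + d *+ k + d = x + d *+ k.+1 by rewrite mulrS; ring.
have -> : x + d *+ k + d *+ 2 = x + d *+ k.+2 by rewrite !mulrS; ring.
lra.
Qed.

(** A bounded function with nondecreasing increments cannot have a positive one:
    it would then grow at least linearly. *)
Lemma midconvex_nonincreasing (x d : R) : 0 <= x -> 0 <= d -> phi (x + d) <= phi x.
Proof.
move=> x0 d0; rewrite leNgt; apply/negP => lt_phi.
pose s := phi (x + d) - phi x; have s0 : 0 < s by rewrite /s; lra.
pose n := (Num.truncn s^-1).+1.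
have := @convex_seq_chord (fun k => phi (x + d *+ k)) 1 n (grid_convex x0 d0) isT.
rewrite mulr0n mulr1n addr0 mul1r -/s => le_ns.
have : 1 < n%:R * s by rewrite -ltr_pdivrMr// div1r /n truncnS_gt.
have := phi_ub (x := x + d *+ n); rewrite addr_ge0 ?mulrn_wge0// => /(_ isT).
have := phi_lb x0; lra.
Qed.

(** Midpoint convexity gives the inequality for rational t along an arithmetic
    progression; since phi is nonincreasing, real t follows by approximation
    from below. *)
Lemma midconvex_chord (x r t : R) : 0 <= x -> 0 <= t <= 1 -> 0 <= r ->
  t * (phi x - phi (x + r)) <= phi x - phi (x + t * r).
Proof.
move=> x0 /andP[t0 t1] r0.
have := midconvex_nonincreasing x0 r0; rewrite -subr_ge0 => g0.
have [->|tn0] := eqVneq t 0; first by rewrite !mul0r addr0 subrr.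
have tp : 0 < t by rewrite lt_def tn0.
have sub s : 0 <= s -> s < t ->
    s * (phi x - phi (x + r)) <= phi x - phi (x + t * r).
  move=> s0 lt_st.
  have [q q1 q2] : exists2 q : rat, s < ratr q & ratr q < t.
    by have [q] := rat_in_itvoo lt_st; rewrite in_itv => /andP[]; exists q.
  have q0 : 0 <= q by rewrite -(@ler0q R); apply: le_trans s0 (ltW q1).
  pose m := `|numq q|%N; pose n := `|denq q|%N.
  have nE : (n%:R : R) = (denq q)%:~R by rewrite natr_absz gtr0_norm ?denq_gt0.
  have mE : (m%:R : R) = (numq q)%:~R by rewrite natr_absz ger0_norm ?numq_ge0.
  have n0 : (0 : R) < n%:R by rewrite nE ltr0z denq_gt0.
  have qE : ratr q = m%:R / n%:R :> R by rewrite /ratr mE nE.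
  have le_mn : (m <= n)%N.
    rewrite -(@ler_nat R) -[leRHS]mul1r -ler_pdivrMr// -qE.
    exact: ltW (lt_le_trans q2 t1).
  have d0 : 0 <= r / n%:R by rewrite divr_ge0// ltW.
  have := @convex_seq_chord (fun k => phi (x + (r / n%:R) *+ k)) m n
    (grid_convex x0 d0) le_mn.
  rewrite mulr0n addr0 -[r / n%:R *+ n]mulr_natr divfK ?gt_eqF// => H.
  have dm : phi (x + t * r) <= phi (x + (r / n%:R) *+ m).
    have -> : x + t * r = (x + (r / n%:R) *+ m) + (t - ratr q) * r.
      rewrite qE -mulr_natr; field; exact: lt0r_neq0.
    apply: midconvex_nonincreasing; first by rewrite addr_ge0// mulrn_wge0.
    by rewrite mulr_ge0// subr_ge0 ltW.
  have Hq : ratr q * (phi x - phi (x + r)) <= phi x - phi (x + (r / n%:R) *+ m).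
    rewrite qE mulrAC ler_pdivrMr//; move: H; clear; clearbody m n; lra.
  have : s * (phi x - phi (x + r)) <= ratr q * (phi x - phi (x + r)).
    by rewrite ler_wpM2r// ltW.
  lra.
apply/ler_addgt0Pr => e e0.
pose g := phi x - phi (x + r).
have g1 : g <= 1.
  by rewrite /g; have := phi_ub x0; have := @phi_lb (x + r) (addr_ge0 x0 r0); lra.
have [le_et|lt_te] := leP e t.
  have := sub (t - e); rewrite subr_ge0 le_et ltrBlDr ltrDl e0 => /(_ isT isT).
  rewrite -/g mulrBl => H; have : e * g <= e * 1 by rewrite ler_wpM2l// ltW.
  lra.
have := sub 0 (lexx 0) tp; rewrite mul0r -/g => H.
have : t * g <= t * 1 by rewrite ler_wpM2l// ltW.
lra.
Qed.

Lemma slope_homo (x r s : R) : 0 <= x -> 0 < r -> r <= s ->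
  (phi x - phi (x + s)) / s <= (phi x - phi (x + r)) / r.
Proof.
move=> x0 r0 le_rs; have s0 := lt_le_trans r0 le_rs.
have t01 : 0 <= r / s <= 1.
  by rewrite ler_pdivrMr// mul1r le_rs andbT divr_ge0 ?ltW.
have := midconvex_chord x0 t01 (ltW s0); rewrite divfK ?gt_eqF// => H.
by rewrite ler_pdivlMr// mulrAC (mulrC _ r) mulrAC.
Qed.

(** The slope just after a point is at most the slope of any chord that ends
    there; this is what bounds the approximating forms by a dissipated norm. *)
Lemma slope_le_backward (x h r : R) : 0 <= x -> 0 < h -> 0 < r ->
  (phi (x + h) - phi (x + h + r)) / r <= (phi x - phi (x + h)) / h.
Proof.
move=> x0 h0 r0; have := @slope_homo x h (h + r) x0 h0.
rewrite lerDl ltW// => /(_ isT).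
rewrite addrA !ler_pdivrMr ?addr_gt0// => H.
rewrite mulrAC ler_pdivlMr//; move: H.
rewrite mulrAC ler_pdivlMr//; lra.
Qed.

End convexity.

(** The exponents match: if W k is of order 2^-k(l+1), the recursion bounds
    (W k.+1)^p by 2^-k(l+2), and (l + 2) / p = l + 1.  So an induction closes for
    any prefactor B with B^(p-1) large, where p - 1 = 1/(l+1). *)
Lemma dyadic_decay {R : realType} (l c : R) (W : nat -> R) : 0 < l -> 0 < c ->
    (forall k, 0 <= W k) -> W 0%N <= 1 ->
    (forall k, c * 2 ^+ k * W k.+1 `^ ((l + 2) / (l + 1)) <= W k) ->
  exists2 B, 0 < B & forall k, W k <= B * (2 `^ (- (l + 1))) ^+ k.
Proof.
move=> l0 c0 W0 W1 rec.
pose p := (l + 2) / (l + 1); pose rho : R := 2 `^ (- (l + 1)).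
have rho0 : 0 < rho by rewrite powR_gt0.
have p0 : 0 < p by rewrite divr_gt0; lra.
(* The induction step needs B^(p-1) >= 2 / (rho c), the base case needs B >= 1. *)
pose B := Num.max 1 ((2 / (rho * c)) `^ (l + 1)).
have B0 : 0 < B by rewrite lt_max ltr01.
exists B => // k; elim: k => [|k IHk].
  by rewrite expr0 mulr1; apply: le_trans W1 _; rewrite le_max lexx.
have rhok : (rho ^+ k.+1) `^ p = rho ^+ k.+1 * 2^-1 ^+ k.+1.
  rewrite /rho -!powR_mulrn ?powR_ge0// -!powRrM.
  rewrite -powR_inv1//  -!powRrM -powRD; last by rewrite pnatr_eq0 implybT.
  by congr (_ `^ _); rewrite /p; field; lra.
have W'p : W k.+1 `^ p <= (B * rho ^+ k.+1) `^ p.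
  rewrite powRM ?(ltW B0) ?exprn_ge0 ?(ltW rho0)// rhok.
  have: W k.+1 `^ p <= W k / (c * 2 ^+ k).
    by rewrite ler_pdivlMr ?mulr_gt0 ?exprn_gt0// mulrC; exact: rec.
  move=> /le_trans; apply.
  rewrite ler_pdivrMr ?mulr_gt0 ?exprn_gt0//.
  apply: le_trans IHk _.
  have -> : B `^ p * (rho ^+ k.+1 * 2^-1 ^+ k.+1) * (c * 2 ^+ k) =
      B `^ p * rho * c / 2 * rho ^+ k.
    rewrite !exprS exprVn; field; exact: expf_neq0.
  rewrite ler_wpM2r ?exprn_ge0 ?(ltW rho0)//.
  have rc0 : 0 < 2 / (rho * c) by rewrite divr_gt0// mulr_gt0.
  have Bp : B `^ p = B * B `^ (l + 1)^-1.
    rewrite -{2}(powRr1 (ltW B0)) -powRD ?(gt_eqF B0) ?implybT//.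
    by congr (_ `^ _); rewrite /p; field; lra.
  have : 2 / (rho * c) <= B `^ (l + 1)^-1.
    rewrite -[leLHS]powRr1 ?(ltW rc0)//.
    rewrite -[X in _ `^ X](@divff _ (l + 1)) ?powRrM; last lra.
    by rewrite ge0_ler_powR ?invr_ge0 ?nnegrE ?powR_ge0 ?(ltW B0)//;
      [lra|rewrite le_max lexx orbT].
  rewrite ler_pdivrMr ?mulr_gt0// => H.
  rewrite Bp; have : B * 2 <= B * (B `^ (l + 1)^-1 * (rho * c)) by rewrite ler_pM2l.
  lra.
move: W'p; rewrite -/rho => W'p.
have := @ge0_ler_powR R p^-1 _ (W k.+1 `^ p) ((B * rho ^+ k.+1) `^ p).
rewrite invr_ge0 ltW// !nnegrE !powR_ge0 => /(_ isT isT isT W'p).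
by rewrite -!powRrM divff ?gt_eqF// !powRr1 ?mulr_ge0 ?exprn_ge0// ltW.
Qed.

(** Discrete analogue of the differential inequality W' <= - c W^p.  Adding the
    hypothesis over n <= i < 2n and using that W is nonincreasing gives
    c n W(2n)^p <= W(n), which is the dyadic recursion. *)
Lemma difference_decay {R : realType} (l c : R) (W : nat -> R) :
    0 < l -> 0 < c -> (forall n, 0 <= W n) -> W 1%N <= 1 ->
    (forall n, c * W n `^ ((l + 2) / (l + 1)) <= W n - W n.+1) ->
  exists2 B, 0 < B & forall k, W (2 ^ k)%N <= B * (2 `^ (- (l + 1))) ^+ k.
Proof.
set p := _ / _ => l0 c0 W0 W1 cW.
have p0 : 0 <= p by rewrite /p divr_ge0; lra.
have W_noninc i j : (i <= j)%N -> W j <= W i.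
  move=> /subnK <-; elim: (j - i)%N => // n IHn; rewrite addSn.
  have := cW (n + i)%N; have : 0 <= c * W (n + i)%N `^ p.
    by rewrite mulr_ge0 ?powR_ge0 ?ltW.
  lra.
have Wp i j : (i <= j)%N -> W j `^ p <= W i `^ p.
  by move=> ij; apply: ge0_ler_powR; rewrite ?nnegrE ?p0 ?W_noninc.
have Wsum n m : c * m%:R * W (n + m)%N `^ p <= W n - W (n + m)%N.
  elim: m => [|m IHm]; first by rewrite mulr0 mul0r addn0 subrr.
  rewrite addnS -natr1 mulrDr mulrDl mulr1.
  have : c * m%:R * W (n + m).+1 `^ p <= c * m%:R * W (n + m)%N `^ p.
    by rewrite ler_wpM2l ?mulr_ge0 ?(ltW c0)//; exact: Wp.
  have : c * W (n + m).+1 `^ p <= c * W (n + m)%N `^ p.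
    by rewrite ler_wpM2l ?(ltW c0)//; exact: Wp.
  have := cW (n + m)%N; lra.
apply: (@dyadic_decay R l c (fun k => W (2 ^ k)%N)) => // k.
have := Wsum (2 ^ k)%N (2 ^ k)%N; rewrite natrX addnn -mul2n -expnS.
by have := W0 (2 ^ k.+1)%N; rewrite -/p; lra.
Qed.

(** * Integration against mixtures and almost-everywhere modifications *)

(** The equality of m' and the mixture of the k x on sets passes to nonnegative
    functions.  It turns the strong Markov property, which is stated for
    probabilities of events, into one for expectations. *)
Section mixture.
Context d1 d2 (T : measurableType d1) (Y : measurableType d2) (R : realType).
Variables (m : {measure set T -> \bar R}) (D : set T).
Hypothesis mD : measurable D.
Variables (k : T -> {measure set Y -> \bar R}) (m' : {measure set Y -> \bar R}).
Hypothesis mk : forall U, measurable U -> measurable_fun setT (k ^~ U).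
Hypothesis m'E : forall U, measurable U -> m' U = (\int[m]_(x in D) k x U)%E.
Local Open Scope ereal_scope.
Import HBNNSimple.

Let mixture_nnsfun (h : {nnsfun Y >-> R}) :
  \int[m']_y (h y)%:E = \int[m]_(x in D) \int[k x]_y (h y)%:E.
Proof.
under [RHS]eq_integral do rewrite integralT_nnsfun sintegralE.
rewrite integralT_nnsfun sintegralE ge0_integral_fsum//; last 2 first.
- by move=> r; apply: measurable_funeM; apply: measurable_funTS; exact: mk.
- by move=> r x _; exact: nnsfun_mulemu_ge0.
apply: eq_fsbigr => r; rewrite inE => -[y _ <-].
rewrite m'E// ge0_integralZl ?lee_fin//.
exact/measurable_funTS/mk.
Qed.

Lemma ge0_integral_mixture (f : Y -> \bar R) :
    measurable_fun setT f -> (forall y, 0 <= f y) ->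
  \int[m']_y f y = \int[m]_(x in D) \int[k x]_y f y.
Proof.
move=> mf f0; pose h := nnsfun_approx measurableT mf.
have mh n : measurable_fun setT (EFin \o h n) by exact/measurable_EFinP.
have h_nd y : {homo (fun n => (h n y)%:E) : i j / (i <= j)%N >-> i <= j}.
  by move=> i j ij; rewrite lee_fin; exact/lefP/nd_nnsfun_approx.
have intE (n : {measure set Y -> \bar R}) :
    \int[n]_y f y = limn (fun i => \int[n]_y (h i y)%:E).
  rewrite -monotone_convergence//.
    apply: eq_integral => y _.
    by apply/esym/cvg_lim => //; exact: cvg_nnsfun_approx.
  by move=> i y _; rewrite lee_fin.
transitivity (limn (fun i => \int[m]_(x in D) \int[k x]_y (h i y)%:E)).
  by rewrite intE; apply: congr_lim; apply/funext => i; rewrite mixture_nnsfun.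
rewrite -monotone_convergence//.
- by apply: eq_integral => x _; rewrite intE.
- move=> n; apply: measurable_funTS.
  apply: (measurable_fun_integral_kernel mk); last exact: mh.
  by move=> y /=; rewrite lee_fin.
- by move=> n x _; apply: integral_ge0 => y _; rewrite lee_fin.
- move=> x _ i j ij; apply: ge0_le_integral => //.
  by move=> y _; rewrite lee_fin.
  exact: mh.
  exact: mh.
  by move=> y _; exact: h_nd.
Qed.

End mixture.

Section integral_ae_measurable.
Context d (T : measurableType d) (R : realType) (m : {measure set T -> \bar R}).
Local Open Scope ereal_scope.
Import HBNNSimple.

(** The integral of a nonnegative function is a supremum over the measurable
    simple functions below it, so it makes sense for a non-measurable f; setting
    such a simple function to zero on a measurable null set does not change its
    integral.  This is what allows an exit time to be replaced by a measurable
    version. *)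
Lemma ge0_integral_ae_measurable (f g : T -> \bar R) :
    measurable_fun setT g -> (forall x, 0 <= f x) -> (forall x, 0 <= g x) ->
    {ae m, forall x, f x = g x} ->
  \int[m]_x f x = \int[m]_x g x.
Proof.
move=> mg f0 g0 fg; have [N [mN N0 fgN]] := fg.
have h0 (h : {nnsfun T >-> R}) x : 0 <= (h x)%:E by rewrite lee_fin.
have mh (h : {nnsfun T >-> R}) : measurable_fun setT (EFin \o h).
  exact/measurable_EFinP.
apply/eqP; rewrite eq_le; apply/andP; split.
  rewrite ge0_integralTE//; apply: ge_ereal_sup => _ [h hf <-].
  rewrite -integralT_nnsfun; apply: ae_ge0_le_integral => //.
  - exact: (mh h).
  - apply: filterS fg => x fgx _; rewrite -fgx; exact: hf.
rewrite ge0_integralTE//; apply: ge_ereal_sup => _ [h hg <-].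
have mNc : measurable (~` N) by exact: measurableC.
rewrite (ge0_integralTE _ f0); apply: ereal_sup_ubound.
have fNc x : (~` N) x -> f x = g x by move/(subsetC fgN) => /contrapT.
exists (proj_nnsfun h mNc).
  move=> x /=; rewrite mindicE; have [|_] := boolP (x \in ~` N).
    by rewrite inE mulr1 => /fNc ->; exact: hg.
  by rewrite mulr0.
rewrite -!integralT_nnsfun; apply: ge0_ae_eq_integral => //.
- exact: (mh (proj_nnsfun h mNc)).
- exact: (mh h).
exists N; split => // x /= /not_implyP[_ neq]; apply: contrapT => xN.
by apply: neq => /=; rewrite mindicE mem_set// mulr1.
Qed.

End integral_ae_measurable.

Section integral_mrestr.
Context d (T : measurableType d) (R : realType) (m : {measure set T -> \bar R}).
Local Open Scope ereal_scope.

(** The restricted measure is the mixture over D of Dirac masses. *)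
Lemma ge0_integral_mrestr (D : set T) (mD : measurable D) (f : T -> \bar R) :
    measurable_fun setT f -> (forall x, 0 <= f x) ->
  \int[mrestr m mD]_x f x = \int[m]_(x in D) f x.
Proof.
move=> mf f0.
rewrite (@ge0_integral_mixture _ _ _ _ R m D mD (fun x => dirac x))//.
- by apply: eq_integral => x _; rewrite integral_dirac// diracT mul1e.
- by move=> U mU; exact/measurable_EFinP/measurable_indic.
- by move=> U mU; rewrite integral_indic.
Qed.

End integral_mrestr.

Section law.
Context d1 d2 (T1 : measurableType d1) (T2 : measurableType d2) (R : realType).
Variables (m : {measure set T1 -> \bar R}) (f : T1 -> T2).
Hypothesis mf : measurable_fun setT f.

Definition law : {measure set T2 -> \bar R} :=
  measure_function_pushforward__canonical__measure_function_Measure m mf.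

Lemma ge0_integral_law (g : T2 -> \bar R) : measurable_fun setT g ->
  (forall y, 0 <= g y)%E -> (\int[law]_y g y = \int[m]_x g (f x))%E.
Proof. by move=> mg g0; rewrite ge0_integral_pushforward. Qed.

End law.

(** * Bounded functions and energy dissipation of a symmetric semigroup *)

Section bounded_functions.
Context d (T : measurableType d) (R : realType).

Definition bounded_measurable (f : T -> R) : Prop :=
  measurable_fun setT f /\ exists M, forall x, `|f x| <= M.

Lemma bounded_measurable_cst (c : R) : bounded_measurable (fun=> c).
Proof. by split; [exact: measurable_cst|exists `|c|]. Qed.

Lemma bounded_measurableB f g : bounded_measurable f -> bounded_measurable g ->
  bounded_measurable (fun x => f x - g x).
Proof.
move=> [mf [M fM]] [mg [N gN]]; split; first exact: measurable_funB.
by exists (M + N) => x; rewrite (le_trans (ler_normB _ _))// lerD.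
Qed.

Lemma bounded_measurableM f g : bounded_measurable f -> bounded_measurable g ->
  bounded_measurable (fun x => f x * g x).
Proof.
move=> [mf [M fM]] [mg [N gN]]; split; first exact: measurable_funM.
by exists (M * N) => x; rewrite normrM ler_pM.
Qed.

Definition unit_valued (f : T -> R) : Prop :=
  measurable_fun setT f /\ forall x, 0 <= f x <= 1.

Lemma unit_valued_bounded f : unit_valued f -> bounded_measurable f.
Proof.
move=> [mf f01]; split => //; exists 1 => x.
by have /andP[f0 f1] := f01 x; rewrite ger0_norm.
Qed.

Lemma unit_valuedM f g : unit_valued f -> unit_valued g ->
  unit_valued (fun x => f x * g x).
Proof.
move=> [mf f01] [mg g01]; split; first exact: measurable_funM.
move=> x; have /andP[f0 f1] := f01 x; have /andP[g0 g1] := g01 x.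
by rewrite mulr_ge0//= mulr_ile1.
Qed.

Lemma unit_valued_indic (A : set T) : measurable A -> unit_valued (\1_A : T -> R).
Proof.
move=> mA; split; first exact: measurable_indic.
by move=> x; rewrite indicE; case: (x \in A); rewrite ?lexx ler01.
Qed.

Context (mu : probability T R).

Lemma bounded_integrable f : bounded_measurable f -> mu.-integrable setT (EFin \o f).
Proof.
move=> [mf [M fM]]; apply: measurable_bounded_integrable => //.
  by rewrite (le_lt_trans (probability_le1 _ _)) ?ltry.
exists M; split; first exact: num_real.
by move=> N MN x _; apply: le_trans (fM x) (ltW MN).
Qed.

Lemma bounded_RintegralD f g : bounded_measurable f -> bounded_measurable g ->
  \int[mu]_x (f x + g x) = \int[mu]_x f x + \int[mu]_x g x.
Proof. by move=> bf bg; rewrite RintegralD//; exact: bounded_integrable. Qed.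

Lemma bounded_RintegralB f g : bounded_measurable f -> bounded_measurable g ->
  \int[mu]_x (f x - g x) = \int[mu]_x f x - \int[mu]_x g x.
Proof. by move=> bf bg; rewrite RintegralB//; exact: bounded_integrable. Qed.

Lemma bounded_RintegralZ c f : bounded_measurable f ->
  \int[mu]_x (c * f x) = c * \int[mu]_x f x.
Proof. by move=> bf; rewrite RintegralZl//; exact: bounded_integrable. Qed.

Lemma Rintegral_probability_cst (c : R) : \int[mu]_x c = c.
Proof.
by rewrite (Rintegral_cst mu measurableT) (congr1 fine (probability_setT mu)) mulr1.
Qed.

Lemma bounded_le_Rintegral f g : bounded_measurable f -> bounded_measurable g ->
  (forall x, f x <= g x) -> \int[mu]_x f x <= \int[mu]_x g x.
Proof. by move=> bf bg fg; apply: le_Rintegral => //; exact: bounded_integrable. Qed.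

Lemma unit_Rintegral f : unit_valued f -> 0 <= \int[mu]_x f x <= 1.
Proof.
move=> uf; rewrite Rintegral_ge0 => [|x _]; last by have [_ /(_ x)/andP[]] := uf.
rewrite -[leRHS]Rintegral_probability_cst.
apply: bounded_le_Rintegral; first exact: unit_valued_bounded.
  exact: bounded_measurable_cst.
by move=> x; have [_ /(_ x)/andP[]] := uf.
Qed.

Lemma bounded_variance f : bounded_measurable f ->
  \int[mu]_x (f x - \int[mu]_y f y) ^+ 2 =
  \int[mu]_x (f x ^+ 2) - (\int[mu]_x f x) ^+ 2.
Proof.
move=> bf; set m := \int[mu]_y f y.
have bcst c : bounded_measurable (fun _ : T => c : R) by exact: bounded_measurable_cst.
have b2 : bounded_measurable (fun x => f x ^+ 2).
  exact: (bounded_measurableM bf bf).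
transitivity (\int[mu]_x (f x ^+ 2 - (2 * m * f x - m ^+ 2))).
  by apply: eq_Rintegral => x _; ring.
have bmf : bounded_measurable (fun x => 2 * m * f x).
  exact: (bounded_measurableM (bcst (2 * m)) bf).
have bm2 : bounded_measurable (fun x => 2 * m * f x - m ^+ 2).
  exact: (bounded_measurableB bmf (bcst (m ^+ 2))).
rewrite bounded_RintegralB// bounded_RintegralB//.
rewrite bounded_RintegralZ// Rintegral_probability_cst -/m; ring.
Qed.

End bounded_functions.

(** S is an abstract symmetric semigroup on functions with values in [0, 1]; S is
    applied to no other functions, so every integral is finite. *)
Section energy.
Context disp (T : measurableType disp) (R : realType) (mu : probability T R).
Variable S : R -> (T -> R) -> T -> R.
Hypothesis S_unit : forall t f, 0 <= t -> unit_valued f -> unit_valued (S t f).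
Hypothesis S_add : forall s t f, 0 <= s -> 0 <= t -> unit_valued f ->
  S (s + t) f = S s (S t f).
Hypothesis S_sym : forall t f g, 0 <= t -> unit_valued f -> unit_valued g ->
  \int[mu]_x (S t f x * g x) = \int[mu]_x (f x * S t g x).
Hypothesis S0 : forall f, unit_valued f -> S 0 f = f.

Variable f : T -> R.
Hypothesis uf : unit_valued f.

Let phi t := \int[mu]_x (f x * S t f x).

Let phi_add s t : 0 <= s -> 0 <= t ->
  \int[mu]_x (S s f x * S t f x) = phi (s + t).
Proof.
by move=> s0 t0; rewrite S_sym//; [rewrite -S_add|exact: S_unit].
Qed.

Let phi_mid (x d : R) : 0 <= x -> 0 <= d ->
  0 <= phi x - 2 * phi (x + d) + phi (x + d *+ 2).
Proof.
move=> x0 d0; have x20 : 0 <= x / 2 by lra.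
have xd0 : 0 <= x / 2 + d by lra.
have -> : phi x = \int[mu]_y (S (x / 2) f y * S (x / 2) f y).
  by rewrite phi_add//; congr phi; lra.
have -> : phi (x + d) = \int[mu]_y (S (x / 2) f y * S (x / 2 + d) f y).
  by rewrite phi_add//; congr phi; lra.
have -> : phi (x + d *+ 2) = \int[mu]_y (S (x / 2 + d) f y * S (x / 2 + d) f y).
  by rewrite phi_add//; congr phi; lra.
have b t : 0 <= t -> bounded_measurable (S t f).
  by move=> t0; apply/unit_valued_bounded/S_unit.
have bM s t : 0 <= s -> 0 <= t -> bounded_measurable (fun y => S s f y * S t f y).
  by move=> s0 t0; apply: bounded_measurableM; exact: b.
have bcst c : bounded_measurable (fun _ : T => c : R) by exact: bounded_measurable_cst.
rewrite -bounded_RintegralZ; last exact: bM.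
have b2 := bounded_measurableM (bcst 2) (bM _ _ x20 xd0).
have b3 := bounded_measurableB (bM _ _ x20 x20) b2.
rewrite -bounded_RintegralB//; last exact: bM.
rewrite -bounded_RintegralD//; last exact: bM.
apply: Rintegral_ge0 => y _.
rewrite [leRHS](_ : _ = (S (x / 2) f y - S (x / 2 + d) f y) ^+ 2) ?sqr_ge0//.
by ring.
Qed.

Let phi01 x : 0 <= x -> 0 <= phi x <= 1.
Proof. by move=> x0; apply: unit_Rintegral; apply: unit_valuedM => //; exact: S_unit. Qed.

Let g := S 1 f.
Let form r := r^-1 * \int[mu]_x ((g x - S r g x) * g x).

Let formE r : 0 < r -> form r = (phi 2 - phi (2 + r)) / r.
Proof.
move=> r0; have ug : unit_valued g by exact: S_unit.
have bg := unit_valued_bounded ug.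
have bSg : bounded_measurable (S r g).
  by apply/unit_valued_bounded/S_unit => //; exact: ltW.
rewrite /form mulrC; congr (_ / _).
under eq_Rintegral do rewrite mulrBl.
rewrite bounded_RintegralB; [|exact: bounded_measurableM..].
rewrite /g -S_add//; last exact: ltW.
have r1 : 0 <= r + 1 by rewrite addr_ge0// ltW.
by rewrite !phi_add//; congr (_ - _); congr phi; ring.
Qed.

(** The approximating form of S_1 f is the slope of phi between 2 and 2 + r.
    Convexity makes it monotone in r, hence convergent, and at most the slope of
    the chord of phi over [0, 2]. *)
Lemma energy_dissipation :
  [/\ cvg (form r @[r --> 0^'+]), 0 <= lim (form r @[r --> 0^'+]) &
  2 * lim (form r @[r --> 0^'+]) <=
    \int[mu]_x (f x ^+ 2) - \int[mu]_x (g x ^+ 2)].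
Proof.
have phi_ub x : 0 <= x -> phi x <= 1 by move=> /phi01/andP[].
have phi_lb x : 0 <= x -> 0 <= phi x by move=> /phi01/andP[].
have two0 : (0 : R) < 2 by [].
have form_ub r : 0 < r -> form r <= (phi 0 - phi 2) / 2.
  move=> r0; rewrite formE//.
  by have := slope_le_backward phi_mid phi_ub phi_lb (lexx 0) two0 r0; rewrite add0r.
have fcvg : cvg (form r @[r --> 0^'+]).
  apply: nonincreasing_at_right_is_cvgr; near=> e.
    move=> r s; rewrite !in_itv/= => /andP[r0 _] /andP[s0 _] rs.
    by rewrite !formE//; apply: slope_homo.
  exists ((phi 0 - phi 2) / 2) => _ [r + <-].
  by rewrite /= in_itv/= => /andP[r0 _]; exact: form_ub.
split=> //.
  apply: limr_ge => //; near=> r; have r0 : 0 < r by near: r; exact: nbhs_right_gt.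
  rewrite formE// divr_ge0 ?(ltW r0)// subr_ge0.
  exact: (midconvex_nonincreasing phi_mid phi_ub phi_lb (ltW two0) (ltW r0)).
have : lim (form r @[r --> 0^'+]) <= (phi 0 - phi 2) / 2.
  apply: limr_le => //; near=> r; apply: form_ub; near: r; exact: nbhs_right_gt.
have -> : phi 0 = \int[mu]_x (f x ^+ 2) by rewrite /phi S0.
have -> : phi 2 = \int[mu]_x (g x ^+ 2).
  by rewrite -[2%R]/(1 + 1) -phi_add.
lra.
Unshelve. all: by end_near. Qed.

End energy.

(** * Power-law decay of the chain killed outside G *)

(** Either the dissipation D already removes half of the variance V, or the
    remaining variance V - D is at least V / 2 and the Nash bound applies to it.
    In both cases D dominates w^p, because w <= 1 and p >= 1. *)
Lemma dissipation_lower_bound {R : realType} (p K kappa : R) :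
    1 <= p -> 0 < K -> 0 < kappa ->
  exists2 c, 0 < c & forall w V D : R, 0 <= w <= 1 -> 0 <= D ->
    kappa * w <= 2 * V -> V - D <= K * (D / 2) `^ p^-1 -> c * w `^ p <= D.
Proof.
move=> p1 K0 k0; have p0 : 0 < p by lra.
exists (Num.min (kappa / 4) (2 * (kappa / (4 * K)) `^ p)).
  by rewrite lt_min divr_gt0//= mulr_gt0// powR_gt0// divr_gt0// mulr_gt0.
move=> w V D /andP[w0 w1] D0 wV VD.
have [le_VD|lt_DV] := leP (V / 2) D.
  apply: le_trans (_ : kappa / 4 * w <= D); last lra.
  apply: ler_pM; rewrite ?powR_ge0 ?ge_min ?lexx//.
    by rewrite le_min divr_ge0 ?(ltW k0)//= mulr_ge0// powR_ge0.
  rewrite -[leRHS]powRr1//; have [->|wn0] := eqVneq w 0.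
    by rewrite !powR0// gt_eqF.
  by apply: ger_powR => //; rewrite lt_def wn0 w0.
apply: le_trans (_ : 2 * (kappa / (4 * K)) `^ p * w `^ p <= D).
  by rewrite ler_wpM2r ?powR_ge0// ge_min lexx orbT.
rewrite -mulrA -powRM// ?divr_ge0 ?mulr_ge0 ?(ltW k0) ?(ltW K0)//.
rewrite -ler_pdivlMl// [leRHS]mulrC.
have D20 : 0 <= D / 2 by lra.
have XE : D / 2 = ((D / 2) `^ p^-1) `^ p.
  by rewrite -powRrM mulVf ?gt_eqF// powRr1.
rewrite [leRHS]XE.
apply: ge0_ler_powR; rewrite ?nnegrE ?powR_ge0//; first exact: ltW.
  by rewrite mulr_ge0// divr_ge0 ?mulr_ge0 ?(ltW k0) ?(ltW K0).
rewrite mulrAC ler_pdivrMr ?mulr_gt0//.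
move: VD; set X := _ `^ _. lra.
Qed.

Section killed_chain.
Context disp (T : measurableType disp) (R : realType) (mu : probability T R).
Variable Q : (T -> R) -> T -> R.
Hypothesis Q_unit : forall f, unit_valued f -> unit_valued (Q f).
Hypothesis Q_sym : forall f g, unit_valued f -> unit_valued g ->
  \int[mu]_x (Q f x * g x) = \int[mu]_x (f x * Q g x).
Hypothesis Q_mass : forall f, unit_valued f -> \int[mu]_x Q f x = \int[mu]_x f x.
Variable G : set T.
Hypothesis mG : measurable G.

(** The probability of remaining in G at the times 0, ..., n, as a function of
    the starting point, for the chain with transition operator Q. *)
Fixpoint survival (n : nat) : T -> R :=
  if n is n'.+1 then fun x => \1_G x * Q (survival n') x else \1_G.

Lemma survival_unit n : unit_valued (survival n).
Proof.
elim: n => [|n IHn] /=; first exact: unit_valued_indic.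
by apply: unit_valuedM; [exact: unit_valued_indic|exact: Q_unit].
Qed.

Lemma survival_killed n x : \1_G x * survival n x = survival n x.
Proof.
have GG : \1_G x * \1_G x = \1_G x :> R by rewrite indicE -natrM mulnb andbb.
by case: n => [|n] /=; rewrite ?mulrA GG.
Qed.

(** The operator f |-> 1_G Q f is symmetric on functions that vanish off G. *)
Lemma survival_shift m n :
  \int[mu]_x (survival m x * survival n.+1 x) =
  \int[mu]_x (survival m.+1 x * survival n x).
Proof.
transitivity (\int[mu]_x (survival m x * Q (survival n) x)).
  apply: eq_Rintegral => x _ /=.
  by rewrite mulrA [_ * \1_G x]mulrC survival_killed.
rewrite -Q_sym; try exact: survival_unit.
apply: eq_Rintegral => x _ /=.
by rewrite mulrAC survival_killed mulrC.
Qed.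

Lemma survival_double n :
  \int[mu]_x survival (n * 2) x = \int[mu]_x (survival n x ^+ 2).
Proof.
transitivity (\int[mu]_x (survival 0 x * survival (n * 2) x)).
  by apply: eq_Rintegral => x _; rewrite survival_killed.
have shift k m : \int[mu]_x (survival m x * survival (n + k) x) =
    \int[mu]_x (survival (m + k) x * survival n x).
  elim: k m => [|k IHk] m; first by rewrite !addn0.
  by rewrite addnS survival_shift IHk addSnnS.
by rewrite muln2 -addnn shift add0n.
Qed.

Variables (l K : R).
Hypotheses (l0 : 0 < l) (K0 : 0 < K).
Let p := (l + 2) / (l + 1).
Hypothesis Q_nash : forall f, unit_valued f ->
  exists2 e : R, 0 <= e &
    2 * e <= \int[mu]_x (f x ^+ 2) - \int[mu]_x (Q f x ^+ 2) /\
    \int[mu]_x (Q f x - \int[mu]_y Q f y) ^+ 2 <= K * e `^ p^-1.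
Hypothesis G_not_full : (0 < mu (~` G))%E.

Let p1 : 1 <= p.
Proof.
have l1 : 0 < l + 1 by rewrite addr_gt0.
by rewrite /p ler_pdivlMr// mul1r lerD2l ler1n.
Qed.

Let p0 : 0 <= p.
Proof. exact: le_trans ler01 p1. Qed.

Let W n := \int[mu]_x (survival n x ^+ 2).

Let unit_sqr f : unit_valued f -> unit_valued (fun x : T => f x ^+ 2 : R).
Proof. by move=> uf; exact: (unit_valuedM uf uf). Qed.

Let W01 n : 0 <= W n <= 1.
Proof. exact/unit_Rintegral/unit_sqr/survival_unit. Qed.

(** The function f = survival n vanishes off G.  With m its mean, (f - m)^2 is m^2
    on the complement of G, so the variance V of f is at least kappa m^2, where
    kappa is the mass of that complement; hence kappa |f|^2 = kappa (V + m^2) is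
    at most 2 V. *)
Lemma survival_energy_decay : exists2 c, 0 < c & forall n, c * W n `^ p <= W n - W n.+1.
Proof.
pose kappa := fine (mu (~` G)).
have mGc : measurable (~` G) by exact: measurableC.
have k0 : 0 < kappa.
  by rewrite fine_gt0// G_not_full/= (le_lt_trans (probability_le1 _ mGc)) ?ltry.
have k1 : kappa <= 1.
  by rewrite -lee_fin fineK ?fin_num_measure// probability_le1.
have [c c0 cP] := dissipation_lower_bound p1 K0 k0.
exists c => // n; set f := survival n.
have uf : unit_valued f by exact: survival_unit.
have uQ := Q_unit uf; have bf := unit_valued_bounded uf.
have bQ := unit_valued_bounded uQ.
have [e e0 [eD nash]] := Q_nash uf.
set D := _ - _ in eD.
apply: (@le_trans _ _ D); last first.
  rewrite lerD2l lerN2; apply: bounded_le_Rintegral.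
  - exact/unit_valued_bounded/unit_sqr/survival_unit.
  - exact/unit_valued_bounded/unit_sqr.
  by move=> x /=; rewrite exprMn ler_piMl ?sqr_ge0.
rewrite bounded_variance// in nash.
pose m := \int[mu]_x f x.
apply: (cP _ (W n - m ^+ 2)); [exact: W01|lra| |].
- have kV : kappa * m ^+ 2 <= W n - m ^+ 2.
    rewrite -bounded_variance// -/m.
    have -> : kappa * m ^+ 2 = \int[mu]_x (m ^+ 2 * \1_(~` G) x).
      rewrite bounded_RintegralZ; last exact/unit_valued_bounded/unit_valued_indic.
      by rewrite /Rintegral integral_indic// setIT mulrC.
    have bcst r : bounded_measurable (fun _ : T => r : R).
      exact: bounded_measurable_cst.
    apply: bounded_le_Rintegral.
    + exact: (bounded_measurableM (bcst (m ^+ 2))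
        (unit_valued_bounded (unit_valued_indic R mGc))).
    + have bfm := bounded_measurableB bf (bcst m).
      exact: (bounded_measurableM bfm bfm).
    move=> x; rewrite indicE; have [|_] := boolP (x \in ~` G); last first.
      by rewrite mulr0 sqr_ge0.
    rewrite inE => Gx; rewrite mulr1 -/f /f -survival_killed indicE memNset// mul0r.
    by rewrite sub0r sqrrN.
  have : kappa * W n <= W n by rewrite ler_piMl//; have /andP[] := W01 n.
  have := sqr_ge0 m; have : kappa * (W n - m ^+ 2) <= W n - m ^+ 2.
    rewrite ler_piMl//; apply: le_trans kV; rewrite mulr_ge0 ?sqr_ge0//.
    exact: ltW.
  rewrite mulrBr; lra.
have <- : \int[mu]_x Q f x = m by exact: Q_mass.
apply: le_trans (_ : K * e `^ p^-1 <= _).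
  by apply: le_trans nash; rewrite /D /W -/f; lra.
have D20 : 0 <= D / 2 by lra.
have eD2 : e <= D / 2 by lra.
by rewrite ler_wpM2l ?(ltW K0)// ge0_ler_powR ?nnegrE ?invr_ge0 ?p0 ?D20 ?eD2.
Qed.

Lemma survival_decay : exists2 B, 0 < B & forall k,
  \int[mu]_x survival (2 ^ k * 2) x <= B * (2 `^ (- (l + 1))) ^+ k.
Proof.
have [c c0 cW] := survival_energy_decay.
have [n||B B0 BP] := difference_decay l0 c0 _ _ cW.
- by have /andP[] := W01 n.
- by have /andP[] := W01 1.
by exists B => // k; rewrite survival_double; exact: BP.
Qed.

End killed_chain.

(** * Borel sets of the one-point compactification *)

Section cemetery_measurability.
Context {R : realType} {E : ptopologicalType} (hE : hausdorff_space E).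

Lemma measurable_Some : measurable_fun setT (Some : borel E -> borel (cemetery E)).
Proof.
apply: (@measurability _ _ (borel E) (borel (cemetery E)) setT Some
  (@open (cemetery E))) => //.
move=> _ [B oB <-]; rewrite setTI; apply: sub_sigma_algebra.
by move: B oB; apply/continuousP/one_point_compactification_some_continuous.
Qed.

Lemma measurable_image_Some (A : set (borel E)) :
  measurable A -> measurable (Some @` A : set (borel (cemetery E))).
Proof.
have openS (U : set E) : open U -> measurable (Some @` U : set (borel (cemetery E))).
  by move=> oU; apply: sub_sigma_algebra; exact: one_point_compactification_open_some.
apply: (smallest_sub (C := fun S : set (set E) => sigma_algebra setT S)
  (X := fun U : set E => measurable (Some @` U : set (borel (cemetery E))))); last first.
  by move=> U oU; exact: openS.
split.
- by rewrite image_set0; exact: measurable0.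
- move=> U mU; rewrite (_ : _ @` _ = (Some @` [set: E]) `\` (Some @` U)).
    by apply: measurableD => //; apply: openS; exact: openT.
  apply/seteqP; split => [_ [x [_ Ux] <-]|_ [[x _ <-] nU]].
    by split; [exists x|move=> [y Uy [yx]]; apply: Ux; rewrite -yx].
  by exists x => //; split => // Ux; apply: nU; exists x.
- by move=> F mF; rewrite image_bigcup; exact: bigcup_measurable.
Qed.

Lemma measurable_None : measurable ([set None] : set (borel (cemetery E))).
Proof.
rewrite (_ : [set None] = ~` (Some @` [set: E])).
  by apply: measurableC; apply: measurable_image_Some; exact: measurableT.
apply/seteqP; split => [_ -> [] //|[x|//] nx].
by exfalso; apply: nx; exists x.
Qed.

Lemma measurable_set1 (x : cemetery E) : measurable ([set x] : set (borel (cemetery E))).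
Proof.
case: x => [x|]; last exact: measurable_None.
rewrite -image_set1; apply: measurable_image_Some.
rewrite -[X in measurable X]setCK; apply: measurableC; apply: sub_sigma_algebra.
by apply: closed_openC; apply: compact_closed => //; exact: compact_set1.
Qed.

Lemma measurable_oapp (f : borel E -> \bar R) : measurable_fun setT f ->
  measurable_fun setT (oapp f 0%E : borel (cemetery E) -> \bar R).
Proof.
move=> mf _ B mB; rewrite setTI.
have -> : oapp f 0%E @^-1` B =
    (Some @` (f @^-1` B)) `|` ([set None] `&` [set _ | B 0%E]).
  apply/seteqP; split => [[x|] /= Bx|x [[y By <-]//|[-> //]]].
  - by left; exists x.
  - by right.
apply: measurableU.
  by apply: measurable_image_Some; rewrite -[X in measurable X]setTI; exact: mf.
apply: measurableI; first exact: measurable_None.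
have [B0|nB0] := pselect (B 0%E).
  by rewrite (_ : [set _ | _] = setT)//; apply/seteqP; split.
by rewrite (_ : [set _ | _] = set0)//; apply/seteqP; split.
Qed.

End cemetery_measurability.

(** * The Markov property at a fixed time *)

Section sigma_algebra_facts.
Context {T : Type} (M : set (set T)) (sM : sigma_algebra setT M).

Lemma salgebraC A : M A -> M (~` A).
Proof. by move=> MA; have [_ /(_ A MA) + _] := sM; rewrite setTD. Qed.

Lemma salgebra_bigcup (F : nat -> set T) : (forall n, M (F n)) -> M (\bigcup_n F n).
Proof. by have [_ _] := sM; apply. Qed.

Lemma salgebra_bigcap (F : nat -> set T) : (forall n, M (F n)) -> M (\bigcap_n F n).
Proof.
move=> MF; rewrite -[X in M X]setCK setC_bigcap; apply: salgebraC.
by apply: salgebra_bigcup => n; exact: salgebraC.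
Qed.

Lemma salgebraT : M setT.
Proof. by have [M0 _ _] := sM; rewrite -setC0; exact: salgebraC. Qed.

Lemma salgebra_set0 : M set0. Proof. by have [] := sM. Qed.

End sigma_algebra_facts.

Lemma ae_probability1 d (T : measurableType d) (R : realType) (P : probability T R)
    (A : set T) : measurable A -> P A = 1%E -> {ae P, forall w, A w}.
Proof.
move=> mA PA; exists (~` A); split => //; first exact: measurableC.
by rewrite probability_setC// PA subee.
Qed.

Section markov.
Context {R : realType} {E : ptopologicalType} (hE : hausdorff_space E).
Context {d : measure_display} {Omega : measurableType d}.
Context {X : R -> Omega -> cemetery E} {P : cemetery E -> probability Omega R}.
Hypothesis hX : hunt_process X P.

Lemma measurable_event_at t (B : set (borel (cemetery E))) : 0 <= t ->
  measurable B -> measurable (X t @^-1` B).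
Proof.
move=> t0 mB; rewrite -[X in measurable X]setTI.
exact: (hunt_measurable hX t0).
Qed.

Lemma start_ae x : {ae P x, forall w, X 0 w = x}.
Proof.
apply: ae_probability1; last exact: hunt_normal.
exact: (measurable_event_at (lexx 0) (measurable_set1 hE x)).
Qed.

(** Started at the cemetery, the path has lifetime zero almost surely. *)
Lemma cemetery_absorbing t : 0 <= t -> {ae P None, forall w, X t w = None}.
Proof.
move=> t0; apply: filterS (start_ae None) => w Xw.
apply: (hunt_cemetery hX t0); apply: le_trans (_ : (0 <= _)%E); last by rewrite lee_fin.
by apply: ereal_inf_lbound; exists 0.
Qed.

Definition ge0_measurable (f : borel E -> \bar R) :=
  measurable_fun setT f /\ forall x, (0 <= f x)%E.

Lemma oapp_ge0 (f : borel E -> \bar R) : (forall x, 0 <= f x)%E ->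
  forall y : cemetery E, (0 <= oapp f 0 y)%E.
Proof. by move=> f0 [x|] /=; [exact: f0|exact: lexx]. Qed.

Lemma oapp_transition t f (y : cemetery E) : 0 <= t -> ge0_measurable f ->
  (\int[P y]_w oapp f 0 (X t w) = oapp (transition X P t f) 0 y)%E.
Proof.
move=> t0 [mf f0]; case: y => [x//|] /=.
rewrite -[RHS](integral0 (P None) setT).
apply: ge0_integral_ae_measurable => //; first by move=> w; exact: oapp_ge0.
by apply: filterS (cemetery_absorbing t0) => w ->.
Qed.

Lemma measurable_transition t f : 0 <= t -> ge0_measurable f ->
  ge0_measurable (transition X P t f).
Proof.
move=> t0 [mf f0]; split; last by move=> x; apply: integral_ge0 => w _; exact: oapp_ge0.
pose mX := hunt_measurable hX t0.
have mk U : measurable U ->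
    measurable_fun setT (fun x : borel E => law (P (Some x)) mX U).
  by move=> mU; exact: (measurableT_comp (hunt_kernel hX t0 mU) measurable_Some).
have := measurable_fun_integral_kernel mk (oapp_ge0 f0) (measurable_oapp mf).
apply: eq_measurable_fun => x _.
by rewrite ge0_integral_law//; [exact: measurable_oapp|exact: oapp_ge0].
Qed.

(** A deterministic time is a stopping time; the strong Markov property at s,
    in integrated form, says that the law of X_(s+h) on A is the mixture over A
    of the laws of X_h started from X_s. *)
Lemma markov_at M x s h A f : right_continuous_filtration M -> strong_markov M X P ->
    0 <= s -> 0 <= h -> M s A -> ge0_measurable f ->
  (\int[P x]_(w in A) oapp f 0 (X (s + h) w) =
   \int[P x]_(w in A) oapp (transition X P h f) 0 (X s w))%E.
Proof.
move=> FM SM s0 h0 MA [mf f0].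
have mA : measurable A by exact: (filtration_sub FM s0).
have sh0 : 0 <= s + h by exact: addr_ge0.
have mXh := hunt_measurable hX h0.
have mXsh := hunt_measurable hX sh0.
have [mf' f'0] := (measurable_oapp mf, oapp_ge0 f0).
have stop : stopping_time M (fun=> s%:E).
  split=> [w|t t0]; first by rewrite lee_fin.
  have sMt := filtration_sigma_algebra FM t0.
  have [le_st|lt_ts] := leP s t.
    rewrite (_ : [set _ | _] = setT); first exact: salgebraT sMt.
    by apply/seteqP; split => // w _ /=; rewrite lee_fin.
  rewrite (_ : [set _ | _] = set0); first exact: salgebra_set0 sMt.
  by apply/seteqP; split => // w /=; rewrite lee_fin leNgt lt_ts.
have stopA : stopped_events M (fun=> s%:E) A.
  split=> // t t0; have sMt := filtration_sigma_algebra FM t0.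
  have [le_st|lt_ts] := leP s t.
    rewrite (_ : [set _ | _] = setT) ?setIT.
      exact: (filtration_mono FM s0 le_st).
    by apply/seteqP; split => // w _ /=; rewrite lee_fin.
  rewrite (_ : [set _ | _] = set0) ?setI0; first exact: salgebra_set0 sMt.
  by apply/seteqP; split => // w /=; rewrite lee_fin leNgt lt_ts.
have AT : A `&` [set w | (s%:E < +oo)%E] = A.
  rewrite (_ : [set _ | _] = setT) ?setIT//.
  by apply/seteqP; split => // w _ /=; rewrite ltry.
rewrite -(ge0_integral_mrestr (P x) mA); last 2 first.
- exact: measurableT_comp mf' mXsh.
- by move=> w; exact: f'0.
rewrite -(ge0_integral_law _ mXsh)//.
rewrite (@ge0_integral_mixture _ _ _ _ R (P x) A mA (fun w => law (P (X s w)) mXh))//.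
- apply: eq_integral => w _; rewrite -oapp_transition//.
  by rewrite ge0_integral_law.
- move=> U mU; have mXs := hunt_measurable hX s0.
  exact: (measurableT_comp (hunt_kernel hX h0 mU) mXs).
- move=> U mU; have := SM x _ A h U stop stopA h0 mU.
  rewrite /= AT /at_time /= addr0 => <-.
  by rewrite /pushforward /mrestr setIC.
Qed.

End markov.

(** * The semigroup of a Hunt process and its skeletons *)

Lemma integral_probability_cst d (T : measurableType d) (R : realType)
  (P : probability T R) (r : \bar R) : (\int[P]_w r = r)%E.
Proof.
rewrite integral_cst//; transitivity (r * 1)%E; last by rewrite mule1.
by congr (_ * _)%E; exact: probability_setT.
Qed.

Section semigroup_on_unit_functions.
Context {R : realType} {E : ptopologicalType} (hE : hausdorff_space E).
Context {d : measure_display} {Omega : measurableType d}.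
Context {X : R -> Omega -> cemetery E} {P : cemetery E -> probability Omega R}.
Hypothesis hX : hunt_process X P.
Implicit Types f g : borel E -> R.
Local Notation S := (semigroup X P : R -> (borel E -> R) -> borel E -> R).
Local Notation transition :=
  (transition X P : R -> (borel E -> \bar R) -> borel E -> \bar R).

Lemma unit_ge0_measurable f : unit_valued f -> ge0_measurable (EFin \o f).
Proof.
move=> [mf f01]; split; first exact/measurable_EFinP.
by move=> x; rewrite lee_fin; have /andP[] := f01 x.
Qed.

Lemma semigroupE t f x : 0 <= t -> unit_valued f ->
  (S t f x)%:E = transition t (EFin \o f) x.
Proof.
move=> t0 uf; have [mf f0] := unit_ge0_measurable uf.
rewrite /semigroup fineK// ge0_fin_numE; last first.
  by apply: integral_ge0 => w _; exact: oapp_ge0.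
apply: (@le_lt_trans _ _ (\int[P (Some x)]_w 1)%E); last first.
  by rewrite integral_probability_cst ltry.
apply: ge0_le_integral => //.
- by move=> w _; exact: oapp_ge0.
- exact: measurableT_comp (measurable_oapp mf) (hunt_measurable hX t0).
- move=> w _; case: (X t w) => [y|] /=; last by rewrite lee_fin.
  by rewrite lee_fin; have [_ /(_ y)/andP[]] := uf.
Qed.

Lemma semigroup_unit t f : 0 <= t -> unit_valued f -> unit_valued (S t f).
Proof.
move=> t0 uf; have hf := unit_ge0_measurable uf.
have [mT T0] := measurable_transition hX t0 hf.
split.
  by apply/measurable_EFinP; apply: eq_measurable_fun mT => x _; rewrite /= semigroupE.
move=> x; rewrite -!lee_fin semigroupE// T0/=.
apply: (@le_trans _ _ (\int[P (Some x)]_w 1)%E); last first.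
  by rewrite integral_probability_cst.
have [mf f0] := hf.
apply: ge0_le_integral => //.
- by move=> w _; exact: oapp_ge0.
- exact: measurableT_comp (measurable_oapp mf) (hunt_measurable hX t0).
- move=> w _; case: (X t w) => [y|] /=; last by rewrite lee_fin.
  by rewrite lee_fin; have [_ /(_ y)/andP[]] := uf.
Qed.

Lemma EFin_semigroup t f : 0 <= t -> unit_valued f ->
  EFin \o S t f = transition t (EFin \o f).
Proof. by move=> t0 uf; apply/funext => x; rewrite /= semigroupE. Qed.

Lemma semigroup0 f : unit_valued f -> S 0 f = f.
Proof.
move=> uf; apply/funext => x; apply: EFin_inj; rewrite semigroupE//.
have [mf f0] := unit_ge0_measurable uf.
rewrite /Defs.transition (@ge0_integral_ae_measurable _ _ _ _ _ (cst (f x)%:E))//.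
- exact: integral_probability_cst.
- by move=> w; exact: oapp_ge0.
- by move=> w; exact: f0.
- by apply: filterS (start_ae hE hX (Some x)) => w ->.
Qed.

Lemma semigroupD s t f : 0 <= s -> 0 <= t -> unit_valued f ->
  S (s + t) f = S s (S t f).
Proof.
move=> s0 t0 uf; apply/funext => x; apply: EFin_inj.
rewrite !semigroupE ?addr_ge0//; last exact: semigroup_unit.
rewrite EFin_semigroup// /Defs.transition.
have [M [FM _ SM _]] := hunt_strong hX.
have MT : M s setT by apply: salgebraT (filtration_sigma_algebra FM s0).
exact: (markov_at hE hX (Some x) FM SM s0 t0 MT (unit_ge0_measurable uf)).
Qed.

Definition skeleton_in (h : R) (n : nat) (B : set E) : set Omega :=
  [set w | forall k, (k <= n)%N -> (Some @` B) (X (h *+ k) w)].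

Lemma filtration_skeleton M (h : R) n (B : set (borel E)) (t : R) :
    0 <= h -> h *+ n <= t -> measurable B -> right_continuous_filtration M -> adapted M X ->
  M t (skeleton_in h n B).
Proof.
move=> h0 hnt mB FM AM; have hn0 k : 0 <= h *+ k by rewrite mulrn_wge0.
have t0 : 0 <= t by exact: le_trans hnt.
have sMt := filtration_sigma_algebra FM t0.
rewrite (_ : skeleton_in h n B = \bigcap_k
    (if (k <= n)%N then X (h *+ k) @^-1` (Some @` B) else setT)); last first.
  apply/seteqP; split => [w Bw k _|w Bw k kn]; first by case: ifP => // /Bw.
  by have := Bw k I; rewrite kn.
apply: (salgebra_bigcap sMt) => k; case: ifPn => [kn|_]; last exact: salgebraT sMt.
have hkt : h *+ k <= t by apply: le_trans hnt; rewrite ler_wpMn2l.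
apply: (filtration_mono FM (hn0 k) hkt); apply: AM => //.
exact: measurable_image_Some.
Qed.

(** The induction carries the functions survival j at the end point along:
    one step of the Markov property moves one application of the killed
    operator from the path to the function. *)
Lemma skeleton_survival (h : R) n (B : set (borel E)) x : 0 <= h -> measurable B ->
  P (Some x) (skeleton_in h n B) = (survival (S h) B n x)%:E.
Proof.
move=> h0 mB; have [M [FM AM SM _]] := hunt_strong hX.
pose v := survival (S h) B.
have uv j : unit_valued (v j).
  by apply: survival_unit => // f; exact: semigroup_unit.
have hn0 k : 0 <= h *+ k by rewrite mulrn_wge0.
have Mskel k : M (h *+ k) (skeleton_in h k B) by exact: filtration_skeleton.
have mskel k : measurable (skeleton_in h k B) by exact: (filtration_sub FM (hn0 k)).
have gv j := unit_ge0_measurable (uv j).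
have skelP k w : skeleton_in h k B w -> exists2 y, B y & X (h *+ k) w = Some y.
  by move=> /(_ k (leqnn k))[y By yE]; exists y.
have Bv j y : ~ B y -> v j y = 0.
  by move=> nB; rewrite /v -survival_killed indicE memNset// mul0r.
have claim k : forall j,
    (\int[P (Some x)]_(w in skeleton_in h k B) oapp (EFin \o v j) 0 (X (h *+ k) w) =
     (v (k + j)%N x)%:E)%E.
  elim: k => [|k IHk] j.
    rewrite mulr0n add0n integral_mkcond.
    rewrite (@ge0_integral_ae_measurable _ _ _ _ _ (cst (v j x)%:E))//.
    - exact: integral_probability_cst.
    - by move=> w; apply: erestrict_ge0 => z _; apply: oapp_ge0; exact: (gv j).2.
    - by move=> w; exact: (gv j).2.
    apply: filterS (start_ae hE hX (Some x)) => w Xw; rewrite patchE.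
    have [_|/negP wB] := boolP (w \in skeleton_in h 0 B); first by rewrite Xw.
    rewrite /= Bv// => xB; apply/wB/mem_set => i.
    by rewrite leqn0 => /eqP->; rewrite mulr0n Xw; exists x.
  rewrite addSnnS -IHk.
  transitivity (\int[P (Some x)]_(w in skeleton_in h k B)
      oapp (EFin \o v j) 0 (X (h *+ k + h) w))%E.
    rewrite integral_mkcond [RHS]integral_mkcond; apply: eq_integral => w _.
    rewrite !patchE mulrSr.
    have [/set_mem wk1|wk1] := boolP (w \in skeleton_in h k.+1 B).
      by rewrite mem_set// => i ik; apply: wk1; exact: leqW.
    have [/set_mem wk|//] := boolP (w \in skeleton_in h k B).
    move: wk1; case E' : (X (h *+ k + h) w) => [y|//] wk1.
    rewrite /= Bv// => By; apply/negP : wk1; rewrite negbK; apply/mem_set => i.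
    by rewrite leq_eqVlt => /predU1P[->|/wk//]; rewrite mulrSr E'; exists y.
  rewrite (markov_at hE hX _ FM SM)//.
  apply: eq_integral => w /set_mem/skelP[y By ->] /=.
  by rewrite -semigroupE//; rewrite indicE mem_set// mul1r.
have := claim n 0; rewrite addn0 => <-.
rewrite -[LHS]mul1e -integral_cst//; apply: eq_integral => w /set_mem/skelP[y By ->] /=.
by rewrite indicE mem_set.
Qed.

Context {mu : probability (borel E) R}.
Hypothesis hsym : symmetric_process mu X P.

Lemma semigroup_sym t f g : 0 <= t -> unit_valued f -> unit_valued g ->
  \int[mu]_x (S t f x * g x) = \int[mu]_x (f x * S t g x).
Proof.
move=> t0 uf ug; rewrite /Rintegral.
have [mf f0] := unit_ge0_measurable uf; have [mg g0] := unit_ge0_measurable ug.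
under eq_integral do rewrite EFinM semigroupE//.
under [in RHS]eq_integral do rewrite EFinM semigroupE//.
by congr fine; exact: (hsym t0 mf mg f0 g0).
Qed.

Hypothesis hcons : conservative X P.

Lemma alive_ae x t : 0 <= t -> {ae P (Some x), forall w, X t w <> None}.
Proof.
move=> t0; pose L := [set w | lifetime X w = +oo%E].
have LE : L = \bigcap_n (X n%:R @^-1` (~` [set None])).
  apply/seteqP; split=> [w Lw n _ /= Xn|w Xw].
    have : (lifetime X w <= n%:R%:E)%E by apply: ereal_inf_lbound; exists n%:R.
    by rewrite Lw leye_eq.
  rewrite /L/=; apply/eqP; rewrite -leye_eq; apply: le_ereal_inf_tmp => _ [s [s0 Xs] <-].
  exfalso; pose n := (Num.truncn s).+1.
  apply: (Xw n I); apply: (hunt_cemetery hX) => //.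
  apply: (@le_trans _ _ s%:E); first by apply: ereal_inf_lbound; exists s.
  by rewrite lee_fin ltW// truncnS_gt.
have mL : measurable L.
  rewrite LE; apply: bigcapT_measurable => n; apply: (measurable_event_at hX) => //.
  by apply: measurableC; exact: (@measurable_None E).
apply: filterS (ae_probability1 mL (hcons x)) => w Lw Xt.
have : (lifetime X w <= t%:E)%E by apply: ereal_inf_lbound; exists t.
by rewrite [lifetime X w]Lw leye_eq.
Qed.

(** Symmetry tested against 1, which the conservative semigroup preserves. *)
Lemma semigroup_mass t f : 0 <= t -> unit_valued f ->
  \int[mu]_x S t f x = \int[mu]_x f x.
Proof.
move=> t0 uf; have u1 : unit_valued (fun _ : borel E => 1 : R).
  by split => [|x]; [exact: measurable_cst|rewrite ler01 lexx].
have S1 : S t (fun=> 1) = fun=> 1.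
  apply/funext => x; apply: EFin_inj; rewrite semigroupE// /Defs.transition.
  rewrite (@ge0_integral_ae_measurable _ _ _ _ _ (cst 1%E))//.
  - exact: integral_probability_cst.
  - by move=> w; apply: oapp_ge0 => y; rewrite lee_fin.
  - by apply: filterS (alive_ae x t0) => w; case: (X t w).
have := semigroup_sym t0 uf u1; rewrite S1.
by under eq_Rintegral do rewrite mulr1; under [in RHS]eq_Rintegral do rewrite mulr1.
Qed.

End semigroup_on_unit_functions.

Arguments skeleton_in {R E d Omega} X h n B.

(** * Compact exhaustion of an open set *)

Section compact_exhaustion.
Context {E : ptopologicalType}.

(** A point of G has a compact neighbourhood inside G by local compactness and
    regularity, and a basic open set inside that neighbourhood.  An injection of
    the countable base into the integers indexes the pairs; indices that
    correspond to no suitable basic set receive the empty pair. *)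
Lemma compact_exhaustion (G : set E) : LCCB E -> open G ->
  exists K W : nat -> set E,
    [/\ forall n, compact (K n) /\ K n `<=` G,
        forall n, open (W n) /\ W n `<=` K n & G `<=` \bigcup_n W n].
Proof.
move=> [hE lcE [B /countable_injP[f f_inj] [B_open B_basis]]] oG.
pose good W := exists K : set E, [/\ compact K, W `<=` K & K `<=` G].
have [WK WKP] : {WK : nat -> set E * set E & forall n,
    [/\ open (WK n).1, compact (WK n).2, (WK n).1 `<=` (WK n).2, (WK n).2 `<=` G &
      forall V, B V -> f V = n -> good V -> (WK n).1 = V]}.
  apply: (choice (P := fun n WK => [/\ open WK.1, compact WK.2, WK.1 `<=` WK.2,
    WK.2 `<=` G & forall V, B V -> f V = n -> good V -> WK.1 = V])) => n.
  have [[V [BV fV [K [cK VK KG]]]]|nV] := pselect (exists V, [/\ B V, f V = n & good V]).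
    exists (V, K); split => //=; first exact: B_open.
    by move=> V' BV' fV' _; apply: f_inj; rewrite ?inE// fV fV'.
  exists (set0, set0); split => //=; [exact: open0|exact: compact0|].
  by move=> V BV fV gV; exfalso; apply: nV; exists V.
exists (fun n => (WK n).2), (fun n => (WK n).1); split.
- by move=> n; have [] := WKP n.
- by move=> n; have [] := WKP n.
move=> x Gx.
have [U xU0 [cU clU]] := lcE x I.
have xU : nbhs x U.
  by apply: (@filterS _ (nbhs x) _ (fun y => [set: E] y -> U y)) xU0 => y; apply.
have [V xV clVG] := compact_regular hE cU xU (open_nbhs_nbhs (conj oG Gx)).
have [W [BW Wx] WUV] := B_basis x _ (filterI xU xV).
have gW : good W.
  exists (U `&` closure V); split.
  - by apply: compact_closedI => //; exact: closed_closure.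
  - by move=> y /WUV[Uy Vy]; split => //; exact: subset_closure.
  - by move=> y [_ /clVG].
by exists (f W) => //; have [_ _ _ _ /(_ W BW erefl gW) ->] := WKP (f W).
Qed.

End compact_exhaustion.

Lemma closed_image_Some {E : topologicalType} (K : set E) : hausdorff_space E ->
  compact K -> closed (Some @` K : set (one_point_compactification E)).
Proof.
move=> hE cK; have clK := compact_closed hE cK.
rewrite -openC.
suff -> : ~` (Some @` K) = (Some @` (~` K)) `|` [set None] :> set (option E).
  rewrite openE => -[x|] [] //=.
  - move=> [y Ky [<-]]; apply: (@filterS _ _ _ (Some @` (~` K))).
      by move=> z; left.
    apply: one_point_compactification_some_nbhs; apply: open_nbhs_nbhs; split => //.
    exact: closed_openC.
  - by move=> [].
  - by move=> _; exists K.
apply/seteqP; split=> [[x|] nK|_ [[x Kx <-]|-> [] //]].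
- by left; exists x => // Kx; apply: nK; exists x.
- by right.
- by move=> [y Ky [yx]]; apply: Kx; rewrite -yx.
Qed.

(** * Exit times from compact sets announce the exit time from G *)

Section exit_times.
Context {R : realType} {E : ptopologicalType} (hE : hausdorff_space E).
Context {d : measure_display} {Omega : measurableType d}.
Context {X : R -> Omega -> cemetery E} {P : cemetery E -> probability Omega R}.
Hypothesis hX : hunt_process X P.

Lemma right_continuous_open (U : set (cemetery E)) s w : 0 <= s -> open U ->
  U (X s w) -> exists2 e : R, 0 < e & forall u, s <= u < s + e -> U (X u w).
Proof.
move=> s0 oU Us.
have /nbhs_ballP[e /= e0 eU] : \forall u \near s, s < u -> U (X u w).
  exact: (hunt_right_continuous hX s0 (open_nbhs_nbhs (conj oU Us))).
exists e => // u /andP[]; rewrite le_eqVlt => /predU1P[<- //|su use].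
by apply: eU => //; rewrite /ball/= ltr0_norm ?subr_lt0// opprB ltrBlDl.
Qed.

Definition stay (t : R) (D : set E) : set Omega :=
  [set w | forall s, 0 <= s <= t -> (Some @` D) (X s w)].

(** If X leaves the closed set D at some s < t, then by right continuity it is
    outside D on a whole interval after s, which contains a dyadic multiple of t;
    the end point t belongs to every grid. *)
Lemma stay_skeleton t (D : set E) : 0 <= t -> closed (Some @` D : set (cemetery E)) ->
  stay t D = \bigcap_m skeleton_in X (t / 2 ^+ m) (2 ^ m) D.
Proof.
move=> t0 clD; have pow0 m : 0 < 2 ^+ m :> R by rewrite exprn_gt0.
have mesh0 m : 0 <= t / 2 ^+ m by rewrite divr_ge0// ltW.
apply/seteqP; split=> [w Dw m _ k km|w Dw s /andP[s0 st]].
  apply: Dw; rewrite mulrn_wge0//= -[leLHS]mulr_natr mulrAC ler_pdivrMr// ler_wpM2l//.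
  by rewrite -natrX ler_nat.
apply: contrapT => nDs.
move: st; rewrite le_eqVlt => /predU1P[st|st].
  apply: nDs; have := Dw 0%N I 1%N (leqnn _).
  by rewrite expr0 divr1 mulr1n st.
have [e e0 eD] := right_continuous_open s0 (closed_openC clD) nDs.
have tp : 0 < t by exact: le_lt_trans st.
(* 2^m > m > t / e makes the mesh finer than e, and k is the first index of the
   grid beyond s. *)
pose m := (Num.truncn (t / e)).+1.
have mesh_lt : t / 2 ^+ m < e.
  rewrite ltr_pdivrMr// mulrC -ltr_pdivrMr//.
  apply: lt_trans (_ : m%:R < _); first exact: truncnS_gt.
  by rewrite -natrX ltr_nat ltn_expl.
pose r := s / (t / 2 ^+ m); pose k := (Num.truncn r).+1.
have mp : 0 < t / 2 ^+ m by rewrite divr_gt0.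
have r0 : 0 <= r by rewrite divr_ge0// ltW.
have /andP[kr rk] := truncn_itv r0.
have km : (k <= 2 ^ m)%N.
  rewrite -(@ltr_nat R); apply: le_lt_trans kr _.
  by rewrite natrX /r ltr_pdivrMr// mulrC divfK// gt_eqF.
apply: (eD (t / 2 ^+ m *+ k)); last exact: Dw.
have kE : t / 2 ^+ m *+ k = (t / 2 ^+ m) * k%:R by rewrite mulr_natr.
have rE : s = (t / 2 ^+ m) * r by rewrite /r mulrC divfK// gt_eqF.
rewrite kE {1}rE ler_pM2l// ltW//=.
have -> : k%:R = (Num.truncn r)%:R + 1 :> R by rewrite /k natr1.
rewrite mulrDr mulr1; apply: ler_ltD => //.
by rewrite [leRHS]rE ler_pM2l.
Qed.

Lemma exit_time_ge0 (D : set E) w : (0 <= exit_time X D w)%E.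
Proof. by apply: le_ereal_inf_tmp => _ [t [t0 _] <-]; rewrite lee_fin. Qed.

Lemma stay_le_exit t (D : set E) w : stay t D w -> (t%:E <= exit_time X D w)%E.
Proof.
move=> Dw; apply: le_ereal_inf_tmp => _ [s [s0 nD] <-]; rewrite lee_fin leNgt.
by apply/negP => st; apply/nD/Dw; rewrite s0 ltW.
Qed.

Lemma lt_exit_stay t (D : set E) w : (t%:E < exit_time X D w)%E -> stay t D w.
Proof.
move=> tD s /andP[s0 st]; apply: contrapT => nD.
have : (exit_time X D w <= s%:E)%E by apply: ereal_inf_lbound; exists s.
by rewrite leNgt (le_lt_trans _ tD)// lee_fin.
Qed.

Lemma stay_anti s t (D : set E) : s <= t -> stay t D `<=` stay s D.
Proof. by move=> st w Dw u /andP[u0 us]; apply: Dw; rewrite u0 (le_trans us). Qed.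

(** The shift N makes all the sets of the union depend only on the path up to a
    time as close to t as desired. *)
Lemma exit_time_gtE t (D : set E) N :
  [set w | (t%:E < exit_time X D w)%E] =
  \bigcup_m stay (t + (m + N).+1%:R^-1) D.
Proof.
apply/seteqP; split=> [w /= tD|w [m _ /stay_le_exit]]; last first.
  by apply: lt_le_trans; rewrite lte_fin ltrDl.
have [r [tr rD]] : exists r, t < r /\ (r%:E < exit_time X D w)%E.
  move: tD; case: (exit_time X D w) => [e| |//]; last first.
    by exists (t + 1); rewrite ltrDl ltr01 ltry.
  by rewrite lte_fin => te; exists ((t + e) / 2); rewrite lte_fin midf_lt// midf_lt.
pose m := Num.truncn (r - t)^-1.
exists m => //; apply: (stay_anti _ (lt_exit_stay rD)).
rewrite -lerBrDl invf_ple ?posrE ?subr_gt0//.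
apply: ltW; apply: lt_le_trans (truncnS_gt _) _.
by rewrite ler_nat ltnS leq_addr.
Qed.

Lemma filtration_stay M t s (D : set (borel E)) : right_continuous_filtration M ->
    adapted M X -> 0 <= t -> t <= s -> measurable D ->
    closed (Some @` D : set (cemetery E)) -> M s (stay t D).
Proof.
move=> FM AM t0 ts mD clD; rewrite stay_skeleton//.
have sMs := filtration_sigma_algebra FM (le_trans t0 ts).
apply: (salgebra_bigcap sMs) => m.
apply: filtration_skeleton => //; first by rewrite divr_ge0// exprn_ge0.
by rewrite -[leLHS]mulr_natr natrX divfK// expf_neq0.
Qed.

(** By right continuity of the filtration it is enough to decide whether the exit
    occurs by time t from the path up to any s > t; N is chosen so that
    t + 1/(m + N + 1) <= s. *)
Lemma exit_time_stopping M (D : set (borel E)) : right_continuous_filtration M ->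
    adapted M X -> measurable D -> closed (Some @` D : set (cemetery E)) ->
  stopping_time M (exit_time X D).
Proof.
move=> FM AM mD clD; split; first exact: exit_time_ge0.
move=> t t0; apply: (filtration_right FM t0) => s ts.
have sMs := filtration_sigma_algebra FM (le_trans t0 (ltW ts)).
pose N := Num.truncn (s - t)^-1.
have -> : [set w | (exit_time X D w <= t%:E)%E] =
    ~` (\bigcup_m stay (t + (m + N).+1%:R^-1) D).
  by rewrite -exit_time_gtE; apply/seteqP; split => w /=; rewrite leNgt => /negP.
apply: (salgebraC sMs); apply: (salgebra_bigcup sMs) => m.
apply: filtration_stay => //; first by rewrite addr_ge0// invr_ge0.
rewrite -lerBrDl invf_ple ?posrE ?subr_gt0//.
apply: ltW; apply: lt_le_trans (truncnS_gt _) _.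
by rewrite ler_nat ltnS leq_addl.
Qed.

Lemma exit_time_mono (C D : set E) w : C `<=` D -> (exit_time X C w <= exit_time X D w)%E.
Proof.
move=> CD; apply: ereal_inf_le_tmp => _ [t [t0 nD] <-]; exists t => //; split => //.
by move=> [y Cy yX]; apply: nD; exists y => //; exact: CD.
Qed.

(** If X were in U at its exit time from D, right continuity would keep it in
    U, hence in D, for a little longer. *)
Lemma exit_time_notin_open (U D : set E) s w : open U -> U `<=` D ->
  exit_time X D w = s%:E -> ~ (Some @` U) (X s w).
Proof.
move=> oU UD Ds Us.
have s0 : 0 <= s by rewrite -lee_fin -Ds exit_time_ge0.
have [e e0 eU] :=
  right_continuous_open s0 (one_point_compactification_open_some U oU) Us.
have : stay (s + e / 2) D w.
  move=> u /andP[u0 use]; have [us|su] := ltP u s.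
    by apply: (@lt_exit_stay u); rewrite ?u0 ?lexx// Ds lte_fin.
  have [y Uy yX] : (Some @` U) (X u w).
    by apply: eU; rewrite su/=; apply: le_lt_trans use _; lra.
  by exists y => //; exact: UD.
by move/stay_le_exit; rewrite Ds lee_fin; lra.
Qed.

Section exhausted.
Variables (G : set E) (D W : nat -> set E).
Hypothesis cD : forall n, compact (D n) /\ D n `<=` G.
Hypothesis D_mono : forall n, D n `<=` D n.+1.
Hypothesis oW : forall n, open (W n) /\ W n `<=` D n.+1.
Hypothesis GW : G `<=` \bigcup_n W n.

Lemma measurable_compact (K : set (borel E)) : compact (K : set E) -> measurable K.
Proof.
move=> cK; rewrite -[X in measurable X]setCK; apply: measurableC.
by apply: sub_sigma_algebra; apply: closed_openC; exact: compact_closed.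
Qed.

Definition announced_exit w := ereal_sup (range (fun n => exit_time X (D n) w)).

Lemma D_le m n : (m <= n)%N -> D m `<=` D n.
Proof.
by move=> /subnK <-; elim: (n - m)%N => // k IHk x Dx; apply/D_mono/IHk.
Qed.

Lemma announced_exit_le w : (announced_exit w <= exit_time X G w)%E.
Proof. by apply: ge_ereal_sup => _ [n _ <-]; apply: exit_time_mono; have [] := cD n. Qed.

(** On the event that the limit s of the exit times is finite, X at these times
    converges to X s.  If X s were in G it would lie in some open W i, and X
    would be in W i at the exit time from D n for large n, which
    [exit_time_notin_open] excludes.  So X s is outside G. *)
Lemma exit_time_announced x : {ae P x, forall w, exit_time X G w = announced_exit w}.
Proof.
have [M [FM AM _ QM]] := hunt_strong hX.
have stopD n : stopping_time M (exit_time X (D n)).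
  have [cDn _] := cD n.
  by apply: exit_time_stopping => //;
    [exact: measurable_compact|exact: closed_image_Some].
have monoD n w : (exit_time X (D n) w <= exit_time X (D n.+1) w)%E.
  exact/exit_time_mono/D_mono.
apply: filterS (QM x (fun n => exit_time X (D n)) stopD monoD) => w qlc.
apply/eqP; rewrite eq_le announced_exit_le andbT.
have le_sup n : (exit_time X (D n) w <= announced_exit w)%E.
  by apply: ereal_sup_ubound; exists n.
have {}qlc : (announced_exit w < +oo)%E ->
    at_time X (exit_time X (D n)) 0 w @[n --> \oo] --> X (fine (announced_exit w) + 0) w.
  by move=> fin; exact: qlc.
move: qlc le_sup; case: (announced_exit w) => [s| |].
- move=> /(_ (ltry _)); rewrite /= addr0 => cvgX le_s.
  have s0 : 0 <= s by rewrite -lee_fin; apply: le_trans (le_s 0%N); exact: exit_time_ge0.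
  apply: ereal_inf_lbound; exists s => //; split=> // -[y Gy yX].
  have [i _ Wy] := GW Gy; have [oWi WDi] := oW i.
  have Ws : (Some @` W i) (X s w) by rewrite -yX; exists y.
  have nW := open_nbhs_nbhs (conj (one_point_compactification_open_some _ oWi) Ws).
  have [N _ NW] := cvgX _ nW.
  pose n := maxn N i.+1.
  have := NW n (leq_maxl _ _).
  have finD : exit_time X (D n) w = (fine (exit_time X (D n) w))%:E.
    rewrite fineK// ge0_fin_numE ?exit_time_ge0//.
    by apply: le_lt_trans (le_s n) _; rewrite ltry.
  rewrite /= /at_time addr0; apply: (exit_time_notin_open oWi _ finD).
  by apply: subset_trans WDi _; apply: D_le; exact: leq_maxr.
- by rewrite leey.
- move=> _ /(_ 0%N); rewrite leeNy_eq => /eqP D0; have := exit_time_ge0 (D 0%N) w.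
  by rewrite D0.
Qed.

Lemma announced_exit_gtE t :
  [set w | (t%:E < announced_exit w)%E] =
  \bigcup_n \bigcup_m stay (t + m.+1%:R^-1) (D n).
Proof.
apply/seteqP; split=> [w /= /ereal_sup_gt[_ [n _ <-] tD]|w [n _]].
  have : [set w | (t%:E < exit_time X (D n) w)%E] w by [].
  rewrite (exit_time_gtE t (D n) 0) => -[m _]; rewrite addn0 => Dm.
  by exists n => //; exists m.
have -> : \bigcup_m stay (t + m.+1%:R^-1) (D n) =
    [set w | (t%:E < exit_time X (D n) w)%E].
  by rewrite (exit_time_gtE t (D n) 0); apply: eq_bigcupr => m _; rewrite addn0.
by move=> /= tD; apply: lt_le_trans tD _; apply: ereal_sup_ubound; exists n.
Qed.

End exhausted.
End exit_times.

(** * Measurability of expectations in the starting point *)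

Section expectation_measurable.
Context {R : realType} {E : ptopologicalType} (hE : hausdorff_space E).
Context {d : measure_display} {Omega : measurableType d}.
Context {X : R -> Omega -> cemetery E} {P : cemetery E -> probability Omega R}.
Hypothesis hX : hunt_process X P.

(** These events are closed under monotone limits, which leads from skeletons to
    exit times. *)
Definition kernel_event (A : set Omega) : Prop :=
  measurable A /\ measurable_fun setT ((fun x => P (Some x) A) : borel E -> \bar R).

Lemma kernel_event_bigcup (F : nat -> set Omega) : (forall n, kernel_event (F n)) ->
  (forall m n, (m <= n)%N -> F m `<=` F n) -> kernel_event (\bigcup_n F n).
Proof.
move=> kF ndF; have mF n : measurable (F n) by have [] := kF n.
have mU : measurable (\bigcup_n F n) by exact: bigcupT_measurable.
split=> //; apply: (emeasurable_fun_cvg (fun n (x : borel E) => P (Some x) (F n))).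
  by move=> n; have [] := kF n.
by move=> x _; apply: nondecreasing_cvg_mu => // m n mn; apply/subsetPset/ndF.
Qed.

Lemma kernel_event_bigcap (F : nat -> set Omega) : (forall n, kernel_event (F n)) ->
  (forall m n, (m <= n)%N -> F n `<=` F m) -> kernel_event (\bigcap_n F n).
Proof.
move=> kF ndF; have mF n : measurable (F n) by have [] := kF n.
have mU : measurable (\bigcap_n F n) by exact: bigcapT_measurable.
split=> //; apply: (emeasurable_fun_cvg (fun n (x : borel E) => P (Some x) (F n))).
  by move=> n; have [] := kF n.
move=> x _; apply: nonincreasing_cvg_mu => //.
  by apply: le_lt_trans (probability_le1 _ (mF 0%N)) _; rewrite ltry.
by move=> m n mn; apply/subsetPset/ndF.
Qed.

Lemma kernel_event_stay t (D : set (borel E)) : 0 <= t -> measurable D ->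
  closed (Some @` D : set (cemetery E)) -> kernel_event (stay (X := X) t D).
Proof.
move=> t0 mD clD; rewrite (stay_skeleton hX)//.
have mesh0 m : 0 <= t / 2 ^+ m by rewrite divr_ge0// exprn_ge0.
apply: kernel_event_bigcap => [m|m n mn w Dw k km].
  have [M [FM AM _ _]] := hunt_strong hX; split.
    have t1 : 0 <= t / 2 ^+ m *+ 2 ^ m by rewrite mulrn_wge0.
    by apply: (filtration_sub FM t1); exact: filtration_skeleton.
  pose Q : (borel E -> R) -> borel E -> R := semigroup X P (t / 2 ^+ m).
  have uS : unit_valued (survival Q D (2 ^ m)).
    by apply: survival_unit => // f; exact: semigroup_unit.
  have /measurable_EFinP := uS.1; apply: eq_measurable_fun => x _ /=.
  by rewrite (skeleton_survival hE hX).
have le_kn : (k * 2 ^ (n - m) <= 2 ^ n)%N.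
  have -> : (2 ^ n = 2 ^ m * 2 ^ (n - m))%N by rewrite -expnD subnKC.
  by rewrite leq_mul2r km orbT.
have := Dw _ le_kn.
suff -> : t / 2 ^+ n *+ (k * 2 ^ (n - m)) = t / 2 ^+ m *+ k by [].
rewrite -[LHS]mulr_natr -[RHS]mulr_natr natrM natrX.
have -> : 2 ^+ n = 2 ^+ m * 2 ^+ (n - m) :> R by rewrite -exprD subnKC.
by field; rewrite !expf_neq0.
Qed.

Section exhausted.
Variables (D : nat -> set E).
Hypothesis cD : forall n, compact (D n).
Hypothesis D_mono : forall n, D n `<=` D n.+1.

Lemma kernel_event_announced t :
  kernel_event [set w | (t < announced_exit (X := X) D w)%E].
Proof.
have T0 w : (0 <= announced_exit (X := X) D w)%E.
  apply: (@le_trans _ _ (exit_time X (D 0%N) w)); first exact: exit_time_ge0.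
  by apply: ereal_sup_ubound; exists 0%N.
have [t0|t0] := leP 0%E t; last first.
  rewrite (_ : [set _ | _] = setT).
    split => //; apply: (eq_measurable_fun (cst 1%E)) => // x _.
    by rewrite /= -[LHS](@probability_setT _ _ _ (P (Some x))).
  by apply/seteqP; split => // w _ /=; exact: lt_le_trans (T0 w).
case: t t0 => [t| |//]; last first.
  rewrite (_ : [set _ | _] = set0).
    move=> _; split => //; apply: (eq_measurable_fun (cst 0%E)) => // x _.
    by rewrite /= measure0.
  by apply/seteqP; split => // w /=; rewrite ltNge leey.
rewrite lee_fin => t0; rewrite announced_exit_gtE.
have stay_sub m n : (m <= n)%N -> t + n.+1%:R^-1 <= t + m.+1%:R^-1 :> R.
  by move=> mn; rewrite lerD2l lef_pV2 ?posrE// ler_nat ltnS.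
have Dle m n : (m <= n)%N -> D m `<=` D n by exact: D_le.
apply: kernel_event_bigcup => [n|m n mn w [i _ Dw]].
  apply: kernel_event_bigcup => [m|i j ij]; last exact/stay_anti/stay_sub.
  apply: kernel_event_stay; first by rewrite addr_ge0// invr_ge0.
    exact: measurable_compact.
  exact: closed_image_Some.
by exists i => // s si; have [y Dy <-] := Dw s si; exists y => //; exact: Dle Dy.
Qed.

Lemma measurable_announced : measurable_fun setT (announced_exit (X := X) D).
Proof.
apply: (@measurability _ _ Omega (\bar R) setT _ _ (ErealGenOInfty.measurableE R)).
move=> _ [_ [r ->] <-]; rewrite setTI.
rewrite (_ : _ @^-1` _ = [set w | (r%:E < announced_exit (X := X) D w)%E]).
  by have [] := kernel_event_announced r%:E.
by apply/seteqP; split => w /=; rewrite in_itv/= andbT.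
Qed.

(** The law of the limit of the exit times is a kernel: by Dynkin's theorem it is
    enough to test it on the rays, which are treated by
    [kernel_event_announced]. *)
Lemma measurable_expectation_announced (g : \bar R -> \bar R) :
    measurable_fun setT g -> (forall y, 0 <= g y)%E ->
  measurable_fun setT ((fun x => \int[P (Some x)]_w g (announced_exit (X := X) D w))%E
    : borel E -> \bar R).
Proof.
move=> mg g0; have mT := measurable_announced.
have mk U : measurable U -> measurable_fun setT
    (fun x : borel E => law (P (Some x)) mT U).
  move=> mU; pose PU U := kernel_event (announced_exit (X := X) D @^-1` U).
  suff [] : PU U by [].
  have GE := ErealGenOInfty.measurableE R.
  have DI := @dynkin_induction _ (\bar R) (@ErealGenOInfty.G R) PU GE.
  apply: DI => //.
  - move=> _ _ [r ->] [s ->]; exists (Num.max r s).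
    apply/seteqP; split=> y /=; rewrite !in_itv/= !andbT EFin_max gt_max.
      by move=> [-> ->].
    by move=> /andP[].
  - rewrite /PU preimage_setT; split=> //; apply: (eq_measurable_fun (cst 1%E)) => // x _.
    by rewrite /= -[LHS](@probability_setT _ _ _ (P (Some x))).
  - move=> _ [r ->]; rewrite /PU.
    rewrite (_ : _ @^-1` _ = [set w | (r%:E < announced_exit (X := X) D w)%E]).
      exact: kernel_event_announced.
    by apply/seteqP; split => w /=; rewrite in_itv/= andbT.
  - move=> S mS [mA mPA]; split; first exact: measurableC.
    apply: (eq_measurable_fun
      (fun x : borel E => 1 - P (Some x) (announced_exit (X := X) D @^-1` S))%E).
      by move=> x _; rewrite /= -probability_setC.
    exact: emeasurable_funB.
  - move=> F mF tF PF; have mFn n : measurable (announced_exit (X := X) D @^-1` F n).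
      by have [] := PF n.
    rewrite /PU preimage_bigcup; split; first exact: bigcupT_measurable.
    apply: (eq_measurable_fun (fun x : borel E =>
      \sum_(n <oo) P (Some x) (announced_exit (X := X) D @^-1` F n))%E).
      move=> x _; rewrite measure_bigcup//.
        by apply: eq_eseriesl => n; rewrite in_setT.
      apply/trivIsetP => i j _ _ ij; rewrite -preimage_setI.
      by move/trivIsetP : tF => /(_ _ _ I I ij) ->; rewrite preimage_set0.
    apply: ge0_emeasurable_sum => // n.
    by have [] := PF n.
  - by have : emeasurable (@ocitv R) U := mU; rewrite GE.
have := measurable_fun_integral_kernel mk g0 mg.
by apply: eq_measurable_fun => x _; rewrite ge0_integral_law.
Qed.

End exhausted.
End expectation_measurable.

(** * Dyadic tail bound for powers *)

Section tail_sum.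
Context {R : realType}.
Variable b : R.
Hypothesis b0 : 0 < b.
Local Open Scope ereal_scope.

(** If 2^(k+1) < y <= 2^(k+2), the term of index k alone dominates y^b; if y is
    infinite, all the terms are at least 1. *)
Lemma poweR_tail_bound (y : \bar R) : 0 <= y ->
  y `^ b <= (2 `^ b)%R%:E +
    \sum_(k <oo) ((2 `^ b) ^+ k.+2)%R%:E *
      (\1_[set z : \bar R | ((2 ^+ k.+1)%R%:E < z)%E] y)%:E.
Proof.
move=> y0; set a := (2 `^ b)%R.
have a1 : (1 <= a)%R.
  by have := @ler_powR R 2 (ler1n R 2) 0%R b (ltW b0); rewrite powRr0.
have a0 : (0 <= a)%R by exact: le_trans ler01 a1.
pose u k := (a ^+ k.+2)%:E * (\1_[set z : \bar R | ((2 ^+ k.+1)%R%:E < z)%E] y)%:E.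
have u0 k : 0 <= u k by rewrite mule_ge0// lee_fin// exprn_ge0.
have u_le k : u k <= \sum_(n <oo) u n.
  apply: le_trans (nneseries_lim_ge k.+1 _) => //.
  by rewrite big_nat_recr//= leeDr// sume_ge0.
have powE k : ((2 ^+ k) `^ b = a ^+ k)%R.
  by rewrite -powR_mulrn// -!powRrM mulrC powRrM powR_mulrn.
case: y y0 @u u0 u_le => [y| |//] y0 u u0 u_le; last first.
  rewrite [X in _ + X](_ : _ = +oo) ?addey ?leey//; apply/eqyP => A A0.
  pose N := (Num.truncn A).+1.
  apply: (@le_trans _ _ (\sum_(0 <= k < N) u k)); last first.
    by apply: (@nneseries_lim_ge R u xpredT 0 N) => k _ _; exact: u0.
  apply: (@le_trans _ _ (\sum_(0 <= k < N) 1%:E)).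
    rewrite sumEFin lee_fin sumr_const_nat subn0 ltW//; exact: truncnS_gt.
  apply: lee_sum => k _; rewrite /u indicE mem_set ?mule1 ?lee_fin ?exprn_ege1//=.
  by rewrite ltry.
move: y0; rewrite lee_fin => y0.
have [y2|y2] := leP y 2%R.
  apply: (@le_trans _ _ a%:E); last first.
    by rewrite leeDl//; apply: nneseries_ge0 => k _ _; exact: u0.
  by rewrite poweR_EFin lee_fin ge0_ler_powR// ?nnegrE// ltW.
have [n yn] : exists n, (y <= 2 ^+ n)%R.
  exists (Num.truncn y).+1; apply: ltW; apply: lt_trans (truncnS_gt _) _.
  by rewrite -natrX ltr_nat ltn_expl.
have [m ym mmin] := ex_minnP (ex_intro (fun n => (y <= 2 ^+ n)%R) n yn).
case: m ym mmin => [|[|k]] ym mmin.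
- by exfalso; move: ym y2; rewrite expr0; lra.
- by exfalso; move: ym y2; rewrite expr1; lra.
have ky : (2 ^+ k.+1 < y)%R.
  by rewrite ltNge; apply/negP => /mmin; rewrite ltnn.
apply: (@le_trans _ _ (u k)); last first.
  by apply: le_trans (u_le k) _; rewrite leeDr// lee_fin.
rewrite /u indicE mem_set ?mule1; last by rewrite /= lte_fin.
rewrite poweR_EFin lee_fin -powE ge0_ler_powR// ?nnegrE// ?exprn_ge0//; exact: ltW.
Qed.

End tail_sum.

(** * From the Nash inequality to dissipation *)

Section bounded_Lp.
Context disp (T : measurableType disp) (R : realType) (mu : probability T R).

Lemma unit_valued_Lfun2 (f : T -> R) : unit_valued f -> f \in Lfun mu 2%:E.
Proof.
move=> uf; have [mf f01] := uf.
rewrite inE; apply/andP; split; first by rewrite inE.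
rewrite inE /= /finite_norm unlock.
apply: poweR_lty; apply: (@le_lt_trans _ _ (\int[mu]_x 1)%E); last first.
  by rewrite integral_probability_cst ltry.
apply: ge0_le_integral => //.
- by move=> x _; exact: poweR_ge0.
- apply: (measurableT_comp (measurable_poweR 2)).
  by apply: measurableT_comp => //; exact/measurable_EFinP.
move=> x _; rewrite poweR_EFin lee_fin; have /andP[fx0 fx1] := f01 x.
by rewrite ger0_norm// powR_mulrn// exprn_ile1.
Qed.

Lemma unit_valued_centered_Linfty (f : T -> R) : unit_valued f ->
  ('N[mu]_+oo[EFin \o (fun x => f x - \int[mu]_y f y)%R] <= 1)%E.
Proof.
move=> uf; have [mf f01] := uf; have /andP[m0 m1] := unit_Rintegral mu uf.
rewrite unlock /=; case: ifPn => // _.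
apply/ess_supP; apply: aeW => x /=; rewrite lee_fin ler_norml.
by have /andP[] := f01 x; lra.
Qed.

End bounded_Lp.

Section nash_dissipation.
Context {R : realType} {E : ptopologicalType} (hE : hausdorff_space E).
Context {mu : probability (borel E) R}.
Context {d : measure_display} {Omega : measurableType d}.
Context {X : R -> Omega -> cemetery E} {P : cemetery E -> probability Omega R}.
Hypothesis hX : hunt_process X P.
Hypothesis hsym : symmetric_process mu X P.
Variables (C p q : R) (Phi : (borel E -> R) -> \bar R) (C' : R).
Hypotheses (C0 : 0 < C) (C'0 : 0 < C') (q0 : 0 < q).
Hypothesis hPhi : L2_functional mu Phi.
Hypothesis nash : forall f : borel E -> R, dirichlet_domain mu X P f ->
  (\int[mu]_x ((f x - \int[mu]_y f y) ^+ 2)%R%:E <=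
   C%:E * (dirichlet_form mu X P f f `^ p^-1)%R%:E * Phi f `^ q^-1)%E.
Hypothesis hPhi_bound : forall f : borel E -> R, f \in Lfun mu 2%:E ->
  (Phi f <= C'%:E * 'N[mu]_+oo[EFin \o (fun x => f x - \int[mu]_y f y)%R] ^+ 2)%E.

(** The number e is the Dirichlet form of g; since g takes values in [0, 1], it
    differs from its mean by at most 1, which bounds Phi g by C'. *)
Lemma nash_dissipation (f : borel E -> R) : unit_valued f ->
  let g : borel E -> R := semigroup X P 1 f in
  exists2 e : R, 0 <= e &
    2 * e <= \int[mu]_x (f x ^+ 2) - \int[mu]_x (g x ^+ 2) /\
    \int[mu]_x (g x - \int[mu]_y g y) ^+ 2 <= C * C' `^ q^-1 * e `^ p^-1.
Proof.
move=> uf g; have ug : unit_valued g by exact: semigroup_unit.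
have [form_cvg e0 eD] := @energy_dissipation _ _ _ mu
  (semigroup X P : R -> (borel E -> R) -> borel E -> R)
  (fun t f t0 uf => semigroup_unit hX t0 uf)
  (fun s t f s0 t0 uf => semigroupD hE hX s0 t0 uf)
  (fun t f g t0 uf ug => semigroup_sym hX hsym t0 uf ug)
  (fun f uf => semigroup0 hE hX uf) f uf.
exists (dirichlet_form mu X P g g) => //; split => //.
have L2g := unit_valued_Lfun2 mu ug.
have Phi_le : (Phi g <= C'%:E)%E.
  apply: le_trans (hPhi_bound L2g) _; rewrite -[leRHS]mule1.
  apply: lee_pmul => //; first by rewrite lee_fin ltW.
    by rewrite expe_ge0// Lnorm_ge0.
  by rewrite expe2 -[leRHS]mule1; apply: lee_pmul => //;
    rewrite ?Lnorm_ge0// unit_valued_centered_Linfty.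
have Phi0 := hPhi.1 _ L2g.
have := nash (f := g) (conj L2g form_cvg).
have bm : bounded_measurable (fun x => (g x - \int[mu]_y g y) ^+ 2).
  have bg := bounded_measurableB (unit_valued_bounded ug)
    (bounded_measurable_cst (borel E) (\int[mu]_y g y)).
  exact: (bounded_measurableM bg bg).
rewrite -[X in (X <= _)%E]fineK; last first.
  by apply: integrable_fin_num => //; exact: bounded_integrable bm.
move=> var_le; rewrite -lee_fin; apply: le_trans var_le _.
rewrite !EFinM muleAC; apply: lee_wpmul2r; first by rewrite lee_fin powR_ge0.
apply: lee_wpmul2l; first by rewrite lee_fin ltW.
by rewrite -poweR_EFin; apply: gt0_ler_poweR => //;
  rewrite ?invr_ge0 ?(ltW q0)// in_itv/= ?leey ?Phi0 ?lee_fin ?(ltW C'0).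
Qed.

End nash_dissipation.

(** * Integrability of the moments of the exit time *)

Lemma integral_poweR_tail d (T : measurableType d) (R : realType)
    (P : probability T R) (Y : T -> \bar R) (b : R) : 0 < b ->
    measurable_fun setT Y -> (forall w, 0 <= Y w)%E ->
  (\int[P]_w (Y w `^ b) <= (2 `^ b)%R%:E +
    \sum_(k <oo) ((2 `^ b) ^+ k.+2)%R%:E * P [set w | (2 ^+ k.+1)%R%:E < Y w])%E.
Proof.
move=> b0 mY Y0; pose a : R := 2 `^ b.
pose A k := [set w | ((2 ^+ k.+1)%R%:E < Y w)%E].
have mA k : measurable (A k).
  by rewrite -[A k]setTI; exact: emeasurable_fun_o_infty.
have ak0 k : 0 <= a ^+ k by rewrite exprn_ge0// powR_ge0.
pose u k w := ((a ^+ k.+2)%:E * (\1_(A k) w)%:E)%E.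
have mu' k : measurable_fun setT (u k).
  by apply: measurable_funeM; exact/measurable_EFinP/measurable_indic.
have u0 k w : (0 <= u k w)%E by rewrite mule_ge0// lee_fin.
apply: (@le_trans _ _ (\int[P]_w (a%:E + \sum_(k <oo) u k w))%E).
  apply: ge0_le_integral => //.
  - by move=> w _; exact: poweR_ge0.
  - exact: (measurableT_comp (measurable_poweR b)).
  - apply: emeasurable_funD => //.
    by apply: ge0_emeasurable_sum => // k _; exact: mu'.
  - move=> w _; apply: le_trans (poweR_tail_bound b0 (Y0 w)) _.
    by rewrite leeD2l//; apply: lee_nneseries => // k _ _; rewrite mule_ge0// lee_fin.
rewrite ge0_integralD//; last 3 first.
- by move=> w _; rewrite lee_fin powR_ge0.
- by move=> w _; exact: nneseries_ge0.
- by apply: ge0_emeasurable_sum => // k _; exact: mu'.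
rewrite integral_probability_cst integral_nneseries// leeD2l//.
apply: lee_nneseries => [k _ _|k _]; first exact: integral_ge0.
rewrite ge0_integralZl_EFin//; last exact/measurable_EFinP/measurable_indic.
by rewrite integral_indic// setIT.
Qed.

Lemma nneseries_geometric_lty (R : realType) (c z : R) : 0 <= c -> 0 <= z < 1 ->
  (\sum_(k <oo) (c * z ^+ k)%:E < +oo)%E.
Proof.
move=> c0 /andP[z0 z1].
apply: (@le_lt_trans _ _ (c / (1 - z))%:E); last by rewrite ltry.
apply: lime_le.
  by apply: is_cvg_nneseries => k _ _; rewrite lee_fin mulr_ge0// exprn_ge0.
apply: nearW => n; rewrite sumEFin lee_fin -mulr_sumr ler_wpM2l//.
have z1' : 0 < 1 - z by rewrite subr_gt0.
rewrite -[leRHS]mul1r ler_pdivlMr// big_mkord.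
have -> : (\sum_(i < n) z ^+ i) * (1 - z) = 1 - z ^+ n.
  by rewrite -opprB mulrN mulrC -subrX1 opprB.
by rewrite gerBl exprn_ge0.
Qed.

Theorem theorem4p1 (R : realType) (E : ptopologicalType) (hE : LCCB E)
    (mu : probability (borel E) R) (hmu : radon mu)
    (d : measure_display) (Omega : measurableType d)
    (X : R -> Omega -> cemetery E) (P : cemetery E -> probability Omega R)
    (hX : hunt_process X P) (hcons : conservative X P)
    (hsym : symmetric_process mu X P)
    (l p q : R) (hl : 0 < l) (hp : p = (l + 2) / (l + 1)) (hq : q = l + 2)
    (C : R) (hC : 0 < C)
    (Phi : (borel E -> R) -> \bar R) (hPhi : L2_functional mu Phi)
    (hPhi_hom : forall (c : R) (f : borel E -> R), f \in Lfun mu 2%:E ->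
      Phi (fun x => c * f x) = ((c ^+ 2)%:E * Phi f)%E)
    (nash : forall f : borel E -> R, dirichlet_domain mu X P f ->
      (\int[mu]_x ((f x - \int[mu]_y f y) ^+ 2)%R%:E <=
       C%:E * (dirichlet_form mu X P f f `^ p^-1)%R%:E * Phi f `^ q^-1)%E)
    (C' : R) (hC' : 0 < C')
    (hPhi_bound : forall f : borel E -> R, f \in Lfun mu 2%:E ->
      (Phi f <=
       C'%:E * 'N[mu]_+oo[EFin \o (fun x => f x - \int[mu]_y f y)%R] ^+ 2)%E) :
  forall (eps : R), 0 < eps -> eps < l + 1 ->
  forall G : set E, open G -> (0 < mu (~` G))%E ->
    mu.-integrable G (fun x =>
      \int[P (Some x)]_w (exit_time X G w `^ (l + 1 - eps)))%E.
Proof.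
move=> eps eps0 epsl G oG muGc.
have [hdE _ _] := hE.
pose b := l + 1 - eps; have b0 : 0 < b by rewrite /b subr_gt0.
have q0 : 0 < q by rewrite hq addr_gt0.
have mG : measurable (G : set (borel E)) by exact: sub_sigma_algebra.
pose S1 : (borel E -> R) -> borel E -> R := semigroup X P 1.
have [B B0 decay] : exists2 B, 0 < B & forall k,
    \int[mu]_x survival S1 G (2 ^ k * 2) x <= B * (2 `^ (- (l + 1))) ^+ k.
  have K0 : 0 < C * C' `^ q^-1 by rewrite mulr_gt0// powR_gt0.
  apply: (survival_decay (mu := mu) _ _ _ mG hl K0 _ muGc) => [f|f g|f|f] uf.
  - exact: semigroup_unit.
  - by move=> ug; exact: semigroup_sym.
  - exact: semigroup_mass.
  - have := nash_dissipation hdE hX hsym hC hC' q0 hPhi nash hPhi_bound uf.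
    by rewrite hp.
have [K [W [cK oW GW]]] := compact_exhaustion hE oG.
pose D n := \bigcup_(i < n) K i.
have cD n : compact (D n) /\ D n `<=` G.
  split; last by move=> x [i _ Kx]; exact: (cK i).2.
  rewrite /D; elim: n => [|n IHn].
    by rewrite (_ : `I_0 = set0) ?bigcup_set0; [exact: compact0|apply/seteqP; split].
  rewrite (_ : `I_n.+1 = `I_n `|` [set n]).
    by rewrite bigcup_setU bigcup_set1; apply: compactU => //; exact: (cK n).1.
  apply/seteqP; split=> i /=; last by case=> [/ltnW|->].
  by rewrite ltnS leq_eqVlt => /predU1P[->|lt_in]; [right|left].
have D_mono n : D n `<=` D n.+1.
  by move=> x [i /= ni Kx]; exists i => //=; exact: ltnW.
have oWD n : open (W n) /\ W n `<=` D n.+1.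
  by have [oWn WK] := oW n; split => // x /WK Kx; exists n => /=.
pose tau := announced_exit (X := X) D.
have mtau : measurable_fun setT tau.
  by apply: (measurable_announced hdE hX) => // n; have [] := cD n.
have tau0 w : (0 <= tau w)%E.
  apply: (@le_trans _ _ (exit_time X (D 0%N) w)); first exact: exit_time_ge0.
  by apply: ereal_sup_ubound; exists 0%N.
have F_eq x : (\int[P (Some x)]_w (exit_time X G w `^ b) =
    \int[P (Some x)]_w (tau w `^ b))%E.
  apply: ge0_integral_ae_measurable.
  - exact: (measurableT_comp (measurable_poweR b)).
  - by move=> w; exact: poweR_ge0.
  - by move=> w; exact: poweR_ge0.
  apply: filterS (exit_time_announced hdE hX cD D_mono oWD GW (Some x)) => w.
  by move=> ->.
pose F x := (\int[P (Some x)]_w (tau w `^ b))%E.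
have F0 x : (0 <= F x)%E by apply: integral_ge0 => w _; exact: poweR_ge0.
have mF : measurable_fun setT (F : borel E -> \bar R).
  apply: (measurable_expectation_announced hdE hX _ D_mono (g := fun y => y `^ b)%E).
  - by move=> n; have [] := cD n.
  - exact: measurable_poweR.
  - by move=> y; exact: poweR_ge0.
apply: (@eq_integrable _ _ _ mu (G : set (borel E)) mG F).
  by move=> x _; rewrite F_eq.
apply/integrableP; split; first exact: measurable_funTS.
pose a : R := 2 `^ b; have a0 k : 0 <= a ^+ k by rewrite exprn_ge0// powR_ge0.
pose v k := survival S1 G (2 ^ k * 2).
have uv k : unit_valued (v k) by apply: survival_unit => // f; exact: semigroup_unit.
have v0 k x : (0 <= (v k x)%:E)%E by rewrite lee_fin; have /andP[] := (uv k).2 x.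
have mv k : measurable_fun setT (EFin \o v k) by apply/measurable_EFinP; exact: (uv k).1.
have tail_le k x : (P (Some x) [set w | (2 ^+ k.+1)%R%:E < tau w] <= (v k x)%:E)%E.
  rewrite -(skeleton_survival hdE hX _ x ler01 mG).
  have [M [FM AM _ _]] := hunt_strong hX.
  apply: le_measure; rewrite ?inE.
  - have cDn n := (cD n).1.
    by have [] := kernel_event_announced hdE hX cDn D_mono (2 ^+ k.+1)%:E.
  - have t0 : 0 <= (1 : R) *+ (2 ^ k * 2) by rewrite mulrn_wge0.
    by apply: (filtration_sub FM t0); exact: filtration_skeleton.
  move=> w /= tw i ik; have : stay (X := X) (2 ^+ k.+1) G w.
    by apply: lt_exit_stay; apply: lt_le_trans tw _; exact: announced_exit_le.
  by apply; rewrite mulrn_wge0//= exprSr -natrX -natrM ler_nat.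
have F_le x : (F x <= a%:E + \sum_(k <oo) (a ^+ k.+2)%:E * (v k x)%:E)%E.
  apply: le_trans (integral_poweR_tail _ b0 mtau tau0) _.
  rewrite leeD2l//; apply: lee_nneseries => [k _ _|k _].
    by rewrite mule_ge0// lee_fin.
  by apply: lee_wpmul2l; [rewrite lee_fin|exact: tail_le].
have mav k : measurable_fun setT (fun x : borel E => (a ^+ k.+2)%:E * (v k x)%:E)%E.
  by apply: measurable_funeM; exact: mv.
have av0 k x : (0 <= (a ^+ k.+2)%:E * (v k x)%:E)%E by rewrite mule_ge0// lee_fin.
have mS : measurable_fun setT
    (fun x : borel E => \sum_(k <oo) (a ^+ k.+2)%:E * (v k x)%:E)%E.
  by apply: ge0_emeasurable_sum => // k _; exact: mav.
have int_v k : (\int[mu]_x (v k x)%:E <= (B * (2 `^ (- (l + 1))) ^+ k)%:E)%E.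
  rewrite -[leLHS]fineK ?lee_fin; first exact: decay.
  apply: integrable_fin_num => //; apply: bounded_integrable.
  exact: unit_valued_bounded.
apply: (@le_lt_trans _ _ (\int[mu]_(x in (setT : set (borel E))) F x)%E).
  under eq_integral do rewrite gee0_abs//.
  by apply: ge0_subset_integral => //; exact: mF.
apply: (@le_lt_trans _ _
    (\int[mu]_x (a%:E + \sum_(k <oo) (a ^+ k.+2)%:E * (v k x)%:E))%E).
  apply: ge0_le_integral => //.
  by apply: emeasurable_funD => //; exact: measurable_cst.
rewrite ge0_integralD//; last 2 first.
- by move=> x _; rewrite lee_fin powR_ge0.
- by move=> x _; apply: nneseries_ge0.
rewrite integral_probability_cst integral_nneseries// lte_add_pinfty ?ltry//.
(* b - (l + 1) = - eps: the series is geometric of ratio 2^-eps. *)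
pose z := a * 2 `^ (- (l + 1)).
have zE : z = 2 `^ (- eps).
  by rewrite /z /a -powRD ?pnatr_eq0 ?implybT//; congr (_ `^ _); rewrite /b; ring.
have z01 : 0 <= z < 1.
  rewrite zE powR_ge0/= powRN invf_lt1 ?powR_gt0//.
  by have := @gt0_ltr_powR R eps eps0 1 2; rewrite !nnegrE ler01 ler0n ltr1n powR1; apply.
have c0 : 0 <= a ^+ 2 * B by apply: mulr_ge0; [exact: a0|exact: ltW].
apply: le_lt_trans (nneseries_geometric_lty c0 z01).
apply: lee_nneseries => [k _ _|k _]; first by apply: integral_ge0 => x _.
rewrite ge0_integralZl_EFin//; last exact: mv.
apply: (@le_trans _ _ ((a ^+ k.+2)%:E * (B * (2 `^ (- (l + 1))) ^+ k)%:E)%E).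
  by apply: lee_wpmul2l; [rewrite lee_fin|exact: int_v].
by rewrite -EFinM lee_fin /z exprMn -addn2 exprD; lra.
Qed.
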